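(* Let $r\ge\beta_1(1)+1$ and let the mesh $\Delta$ be as described in the context. Let $\bar h_\Delta(c)$, $c\in[c_0,c_1]$, be the effective Hamiltonian of the difference Hamilton-Jacobi equation $$\frac{v^{k+1}_m-\frac{v^k_{m-1}+v^k_{m+1}}2}{\Delta t}+H\Big(x_m,t_k,c+\frac{v^k_{m+1}-v^k_{m-1}}{2\Delta x}\Big)=h(c).\qquad(\ast)$$ Then: 1. $h(c)=\bar h_\Delta(c)$ is the unique value for which $(\ast)$ admits a space-time periodic difference solution. 2. $\bar h_\Delta(c)$ is the averaged Hamiltonian; that is, for the space-time periodic difference solution $\bar u^k_m(c)$ of the Lax-Friedrichs scheme, $$\bar h_\Delta(c)=\sum_{0\le k<2K}\ \sum_{\substack{0\le m<2N\\ m+k\text{ even}}}H(x_m,t_k,c+\bar u^k_m(c))\cdot2\Delta x\,\Delta t.$$ 3. Let $v^{l+1}_n(c)$ be a time-global solution of $(\ast)$ with right-hand side $0$ in place of $h(c)$. Then for all $n$ $$\lim_{l\to\infty}\frac{v^{l+1}_n(c)}{t_{l+1}}=-\bar h_\Delta(c).$$ 4. $c\mapsto\bar h_\Delta(c)$ is a convex $C^1$-function. 5. $\bar h_\Delta$ converges uniformly to the exact effective Hamiltonian $\bar h$ as $\Delta\to0$: there is a constant $\beta_3>0$, independent of $\Delta$, with $$\sup_{c\in[c_0,c_1]}|\bar h_\Delta(c)-\bar h(c)|\le\beta_3\sqrt{\Delta x}.$$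
   Context: $\mathbb T=\mathbb R/\mathbb Z$. The function $H=H(x,t,p):\mathbb T^2\times\mathbb R\to\mathbb R$ satisfies: (A1) $H$ is $C^2$; (A2) $H_{pp}>0$; (A3) $\lim_{|p|\to\infty}H(x,t,p)/|p|=+\infty$; (A4) the Legendre transform $L(x,t,\xi)=\sup_{p}\{\xi p-H(x,t,p)\}$ satisfies $|L_x|\le\alpha(|L|+1)$ for some $\alpha>0$. Real numbers $r>0$, $c_0\le c_1$ are fixed. $L^\infty_{r,0}(\mathbb T)$: all $u^0\in L^\infty(\mathbb T)$ with $\|u^0\|_{L^\infty}\le r$, $\int_{\mathbb T}u^0dx=0$. $Lip_r(\mathbb T)$: Lipschitz functions on $\mathbb T$ with Lipschitz constant at most $r$. $\phi^t(u^0;c)=u(\cdot,t)$, where $u$ is the entropy solution of $u_t+H(x,t,c+u)_x=0$, $u(\cdot,0)=u^0$. The exact effective Hamiltonian $\bar h(c)$ is the unique real number such that $v_t+H(x,t,c+v_x)=\bar h(c)$ admits a $\mathbb Z^2$-periodic viscosity solution. Mesh: $N\le K$ are natural numbers, $\Delta x=(2N)^{-1}$, $\Delta t=(2K)^{-1}$, $\lambda=\Delta t/\Delta x$, $x_m=m\Delta x$, $t_k=k\Delta t$. Lax-Friedrichs scheme: $u^k_m$ ($m+k$ even) satisfies $$\frac{u^{k+1}_{m+1}-\frac{u^k_m+u^k_{m+2}}2}{\Delta t}+\frac{H(x_{m+2},t_k,c+u^k_{m+2})-H(x_m,t_k,c+u^k_m)}{2\Delta x}=0,\quad u^k_{m\pm2N}=u^k_m,$$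 with $u^0_m=\frac1{2\Delta x}\int_{x_m-\Delta x}^{x_m+\Delta x}u^0dy$ ($m$ even), $u^0\in L^\infty_{r,0}(\mathbb T)$; $u_\Delta(x,t)=u^k_m$ on $[x_{m-1},x_{m+1})\times[t_k,t_{k+1})$, $\phi^t_\Delta(u^0;c)=u_\Delta(\cdot,t)$. Solutions of $(\ast)$ are $v^k_m$ with $m+k$ odd, $v^k_{m\pm2N}=v^k_m$, and initial data $v^0_{m+1}=v^0(x_{m+1})$ ($m$ even) with $v^0\in Lip_r(\mathbb T)$; then $u^k_m=(v^k_{m+1}-v^k_{m-1})/(2\Delta x)$ solves the Lax-Friedrichs scheme with $u^0=v^0_x$. Let $v_\Delta$ be the piecewise linear interpolation in $x$, $v_\Delta(x,t)=v^k_{m-1}+\frac{v^k_{m+1}-v^k_{m-1}}{2\Delta x}(x-x_{m-1})$ on $[x_{m-1},x_{m+1})\times[t_k,t_{k+1})$ ($m+k$ even), and $\psi^t_\Delta(v^0;c)=v_\Delta(\cdot,t)$. A difference solution is space-time periodic if it has period $1$ in $x$ and in $t$, i.e. it is invariant under $m\mapsto m+2N$ and under $k\mapsto k+2K$. Choice of $r$ and mesh: $\beta_1(1)>0$ is a constant, independent of $r$, $c\in[c_0,c_1]$ and the initial data, such that $\|\phi^1(u^0;c)\|_{L^\infty}\le\beta_1(1)$ for all $c\in[c_0,c_1]$ and all bounded zero-mean $u^0$. Constants $0<\lambda_0<\lambda_1$ and $\delta>0$ are fixed such that, for every mesh with $\lambda_0\le\lambda<\lambda_1$, $\Delta x\le\delta$,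 every $c\in[c_0,c_1]$ and every $u^0\in L^\infty_{r,0}(\mathbb T)$: (i) $|H_p(x_m,t_k,c+u^k_m)|\le\lambda_1^{-1}<\lambda^{-1}$ for all $k\ge0$ and all $m$ with $m+k$ even; (ii) $\|\phi^1_\Delta(u^0;c)\|_{L^\infty}\le\beta_1(1)+1$, so $\phi^1_\Delta(\cdot;c)$ maps $L^\infty_{r,0}(\mathbb T)$ into itself. (Such constants exist.) All meshes satisfy $\lambda_0\le\lambda<\lambda_1$, $\Delta x\le\delta$, and $\Delta\to0$ is taken within this class. Effective Hamiltonian of $(\ast)$: for each $c\in[c_0,c_1]$ there is a constant $\bar h_\Delta(c)$ such that for $h(c)=\bar h_\Delta(c)$ the map $\psi^1_\Delta(\cdot;c)$ has a fixed point in $Lip_r(\mathbb T)$ (unique up to additive constants), i.e. $(\ast)$ has a space-time periodic solution. Correspondingly, $\phi^1_\Delta(\cdot;c)$ has a unique fixed point in $L^\infty_{r,0}(\mathbb T)$, which generates the space-time periodic difference solution $\bar u^k_m(c)$. *)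

(* Defs.v *)
From HB Require Import structures.
From mathcomp Require Import all_boot all_order all_algebra.
From mathcomp Require Import all_classical all_reals all_analysis.
From mathcomp Require Import lra.

Set Implicit Arguments.
Unset Strict Implicit.
Unset Printing Implicit Defensive.

Import Order.TTheory GRing.Theory Num.Theory.
Import numFieldNormedType.Exports.

Local Open Scope classical_set_scope.
Local Open Scope ring_scope.

(* Functions on the torus R/Z are represented by 1-periodic functions on R. *)

(* C^n functions on a finite-dimensional space: a function is C^(n+1) iff all
   its directional derivatives exist everywhere and are C^n. *)
Fixpoint Ck (R : realType) (V : normedModType R) (n : nat) (f : V -> R) : Prop :=
  continuous f /\
  match n with
  | 0%N => True
  | n'.+1 => forall v : V, (forall z, derivable f z v) /\ Ck n' (fun z => 'D_v f z)
  end.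

(* C^1 on the closed interval [a, b], with one-sided derivatives at the
   endpoints. *)
Definition C1_on (R : realType) (a b : R) (f : R -> R) : Prop :=
  exists f' : R -> R,
    {within `[a, b], continuous f'} /\
    {in `[a, b], forall x,
      (f y - f x) / (y - x) @[y --> within `[a, b] (x^')] --> f' x}.

Section hamiltonian.
Context {R : realType}.
Implicit Types H : R -> R -> R -> R.

Definition H_x H (x t p : R) : R := derive1 (fun y => H y t p) x.
Definition H_p H (x t p : R) : R := derive1 (H x t) p.

Definition legendre H (x t xi : R) : R :=
  sup [set xi * p - H x t p | p in [set: R]].

Definition L_x H (x t xi : R) : R := derive1 (fun y => legendre H y t xi) x.

Record hamiltonian_assumptions H : Prop := HamiltonianAssumptions {
  ham_periodic_x : forall t p, periodic (fun x => H x t p) 1 ;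
  ham_periodic_t : forall x p, periodic (fun t => H x t p) 1 ;
  ham_C2 : Ck 2 (fun z : R * R * R => H z.1.1 z.1.2 z.2) ;
  ham_convex : forall x t p, 0 < derive1n 2 (H x t) p ;
  ham_superlinear : forall x t,
    (H x t p / `|p| @[p --> +oo] --> +oo) /\
    (H x t p / `|p| @[p --> -oo] --> +oo) ;
  ham_legendre : exists2 alpha : R, 0 < alpha &
    forall x t xi, `|L_x H x t xi| <= alpha * (`|legendre H x t xi| + 1) }.

End hamiltonian.

Section exact_problem.
Context {R : realType}.
Implicit Types H : R -> R -> R -> R.

Local Notation mu := (@lebesgue_measure R).

(* For a 1-periodic function, the essential supremum over R is that over the
   torus. *)
Definition Linf_norm (u0 : R -> R) : \bar R := 'N[mu]_+oo[EFin \o u0]%E.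

Definition Linf0 (r : R) (u0 : R -> R) : Prop :=
  [/\ measurable_fun [set: R] u0, periodic u0 1,
      (Linf_norm u0 <= r%:E)%E & \int[mu]_(x in `[0, 1]) u0 x = 0].

Definition Lip (r : R) (v0 : R -> R) : Prop := periodic v0 1 /\ r.-lipschitz v0.

Definition partial_x (phi : R * R -> R) (z : R * R) : R :=
  derive1 (fun x => phi (x, z.2)) z.1.
Definition partial_t (phi : R * R -> R) (z : R * R) : R :=
  derive1 (fun t => phi (z.1, t)) z.2.

(* Nonnegative C^oo test functions with compact support in R x ]0, +oo[. *)
Definition test_function (phi : R * R -> R) : Prop :=
  [/\ forall n, Ck n phi,
      forall z, 0 <= phi z &
      exists A : set (R * R),
        [/\ compact A, A `<=` [set z | 0 < z.2] &
            forall z, ~ A z -> phi z = 0]].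

(* Kruzhkov entropy solutions u, in C([0, +oo[; L^1) and bounded on bounded time
   intervals, of u_t + H(x, t, c + u)_x = 0, u(., 0) = u0. *)
Record entropy_solution H (c : R) (u0 : R -> R) (u : R -> R -> R) : Prop := EntropySolution {
  ent_periodic : forall t : R, 0 <= t -> periodic (u ^~ t) 1 ;
  ent_measurable : measurable_fun [set z : R * R | 0 <= z.2]
    (fun z : R * R => u z.1 z.2) ;
  ent_bounded : forall T : R, exists M : R, forall t : R, 0 <= t <= T ->
    (Linf_norm (u ^~ t) <= M%:E)%E ;
  ent_continuous : forall t : R, 0 <= t ->
    (\int[mu]_(x in `[0%R, 1%R]) (`|u x s - u x t|%R)%:E)%E
      @[s --> within `[0, +oo[ (nbhs t)] --> 0%E ;
  ent_initial : {ae mu, forall x, u x 0 = u0 x} ;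
  ent_kruzhkov : forall (k : R) (phi : R * R -> R), test_function phi ->
    0 <= \int[(mu \x mu)%E]_(z in [set z : R * R | 0 < z.2])
      (let w := u z.1 z.2 in
       `|w - k| * partial_t phi z
       + Num.sg (w - k) * (H z.1 z.2 (c + w) - H z.1 z.2 (c + k))
         * partial_x phi z
       - Num.sg (w - k) * H_x H z.1 z.2 (c + k) * phi z) }.

Definition viscosity_subsolution H (c h : R) (v : R -> R -> R) : Prop :=
  forall (phi : R * R -> R) (z : R * R), Ck 1 phi ->
    (\forall w \near z, v w.1 w.2 - phi w <= v z.1 z.2 - phi z) ->
    partial_t phi z + H z.1 z.2 (c + partial_x phi z) <= h.

Definition viscosity_supersolution H (c h : R) (v : R -> R -> R) : Prop :=
  forall (phi : R * R -> R) (z : R * R), Ck 1 phi ->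
    (\forall w \near z, v z.1 z.2 - phi z <= v w.1 w.2 - phi w) ->
    h <= partial_t phi z + H z.1 z.2 (c + partial_x phi z).

Record periodic_viscosity_solution H (c h : R) (v : R -> R -> R) : Prop :=
  PeriodicViscositySolution {
  visc_continuous : continuous (fun z : R * R => v z.1 z.2) ;
  visc_periodic_x : forall t, periodic (v ^~ t) 1 ;
  visc_periodic_t : forall x, periodic (v x) 1 ;
  visc_sub : viscosity_subsolution H c h v ;
  visc_super : viscosity_supersolution H c h v }.

Definition effective_hamiltonian H (c h : R) : Prop :=
  unique (fun h' => exists v, periodic_viscosity_solution H c h' v) h.

End exact_problem.

Section discrete_problem.
Context {R : realType}.
Implicit Types (H : R -> R -> R -> R) (N K k : nat) (m : int).

Local Notation mu := (@lebesgue_measure R).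

Definition dx N : R := (2 * N%:R)^-1.
Definition dt K : R := (2 * K%:R)^-1.
Definition xg N m : R := m%:~R * dx N.
Definition tg K k : R := k%:R * dt K.

Definition mesh (lam0 lam1 delta : R) N K : Prop :=
  [/\ (0 < N <= K)%N, lam0 <= dt K / dx N < lam1 & dx N <= delta].

(* Grid functions are total in (k, m); only the values at m + k even (for u),
   resp. m + k odd (for v), are constrained and used. *)
Definition even_node k m : bool := (2 %| m + k%:Z)%Z.

Record lf_solution H N K (c : R) (u0 : R -> R)
    (u : nat -> int -> R) : Prop := LFSolution {
  lf_scheme : forall k m, even_node k m ->
    (u k.+1 (m + 1) - (u k m + u k (m + 2)) / 2) / dt K
    + (H (xg N (m + 2)) (tg K k) (c + u k (m + 2))
       - H (xg N m) (tg K k) (c + u k m)) / (2 * dx N) = 0 ;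
  lf_periodic : forall k m, even_node k m -> u k (m + (2 * N)%N%:Z) = u k m ;
  lf_initial : forall m, even_node 0 m ->
    u 0%N m = (2 * dx N)^-1
      * \int[mu]_(y in `[xg N m - dx N, xg N m + dx N]) u0 y }.

Record hj_solution H N K (c h r : R) (v0 : R -> R)
    (v : nat -> int -> R) : Prop := HJSolution {
  hj_scheme : forall k m, even_node k m ->
    (v k.+1 m - (v k (m - 1) + v k (m + 1)) / 2) / dt K
    + H (xg N m) (tg K k) (c + (v k (m + 1) - v k (m - 1)) / (2 * dx N)) = h ;
  hj_periodic : forall k m, ~~ even_node k m ->
    v k (m + (2 * N)%N%:Z) = v k m ;
  hj_lip : Lip r v0 ;
  hj_initial : forall m, even_node 0 m -> v 0%N (m + 1) = v0 (xg N (m + 1)) }.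

Definition time_step K (t : R) : nat := Num.truncn (t / dt K).

(* The m with m + k even and x in [x_(m-1), x_(m+1)[, see center_even and
   center_cell. *)
Definition center N k (x : R) : int :=
  k%:Z + 2 * Num.floor ((x / dx N - k%:R + 1) / 2).

Lemma center_even N k x : even_node k (center N k x).
Proof.
by rewrite /even_node /center addrAC -mulr2n -[X in X + _]mulr_natl -mulrDr dvdz_mulr.
Qed.

Lemma center_cell N k x : (0 < N)%N ->
  xg N (center N k x - 1) <= x < xg N (center N k x + 1).
Proof.
move=> N0; have d0 : 0 < dx N by rewrite invr_gt0 mulr_gt0 // ltr0n.
have /andP[] := floor_itv ((x / dx N - k%:R + 1) / 2).
rewrite /xg /center; set n := Num.floor _.
rewrite ler_pdivlMr // ltr_pdivrMr // intrD => h1 h2.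
rewrite -(ler_pdivlMr _ _ d0) -(ltr_pdivrMr _ _ d0).
rewrite !intrD intrN !intrM /=.
rewrite -[k%:~R]/(k%:R) -[2%:~R]/(2%:R) -[1%:~R in X in X && _]/(1 : R).
move: (x / dx N) h1 h2 => y h1 h2; apply/andP; split; lra.
Qed.

Definition u_interp N K (u : nat -> int -> R) (x t : R) : R :=
  let k := time_step K t in u k (center N k x).

Definition v_interp N K (v : nat -> int -> R) (x t : R) : R :=
  let k := time_step K t in
  let m := center N k x in
  v k (m - 1) + (v k (m + 1) - v k (m - 1)) / (2 * dx N) * (x - xg N (m - 1)).

(* A value h for which the time-one map v0 |-> v_Delta(., 1) of the scheme has a
   fixed point in Lip_r; hj_solution includes Lip r v0. *)
Definition discrete_effective_hamiltonian H N K (r c h : R) : Prop :=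
  exists v0 v, hj_solution H N K c h r v0 v /\
    forall x, v_interp N K v x 1 = v0 x.

Definition has_periodic_hj_solution H N K (r c h : R) : Prop :=
  exists v0 v, hj_solution H N K c h r v0 v /\
    forall k m, ~~ even_node k m -> v (k + 2 * K)%N m = v k m.

(* The difference solution generated by a fixed point in L^oo_(r,0) of the
   time-one map u0 |-> u_Delta(., 1); equality in L^oo is equality a.e. *)
Definition periodic_lf_solution H N K (r c : R) (u : nat -> int -> R) : Prop :=
  exists u0, [/\ Linf0 r u0, lf_solution H N K c u0 u &
    {ae mu, forall x, u_interp N K u x 1 = u0 x}].

Definition averaged_hamiltonian H N K (c : R) (u : nat -> int -> R) : R :=
  \sum_(0 <= k < 2 * K) \sum_(0 <= m < 2 * N | even_node k m%:Z)
    H (xg N m%:Z) (tg K k) (c + u k m%:Z) * (2 * dx N * dt K).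

End discrete_problem.

(* Main.v *)
Require Import Defs.
From HB Require Import structures.
From mathcomp Require Import all_boot all_order all_algebra.
From mathcomp Require Import all_classical all_reals all_analysis.
From mathcomp Require Import measurable_realfun ess_sup_inf.
From mathcomp Require Import lra ring zify.
Set Implicit Arguments.
Unset Strict Implicit.
Unset Printing Implicit Defensive.
Import Order.TTheory GRing.Theory Num.Theory.
Import numFieldNormedType.Exports.
Local Open Scope classical_set_scope.
Local Open Scope ring_scope.

(** Everything rests on monotonicity of the scheme, used as a maximum principle.
    Along the slopes u = Dv of a difference solution the CFL bound gives
    |H_p| <= 1/lam1 < dx/dt. As H is convex in p, the secant slope s of H between
    two such values obeys the same bound, so the difference w of two solutions is
    transported by an averaging step with positive weights (1 +- s dt/dx)/2 plus a
    source ([upwind_weights]). At the largest node of a space-time periodic grid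
    function such a step forces the source to be nonnegative
    ([maximum_principle]); a quantitative version bounds the whole oscillation
    of w by the source ([oscillation_le]).

    Uniqueness of the effective value is this principle applied to two periodic
    solutions ([hj_compare]). The averaging formula follows by summing the scheme
    over one period, once a periodic Lax-Friedrichs solution has been integrated in
    x to a Hamilton-Jacobi solution whose initial datum is extended off the grid by
    the McShane formula ([periodic_lf_average]). The long-time average holds since
    v - V + h t stays bounded when V is the periodic solution
    ([long_time_bounded]).

    Convexity: a convex combination of periodic solutions is a subsolution for the
    combined c. Differentiability: the oscillation bound makes the slopes of the
    periodic solution Lipschitz in c; comparing difference quotients of the
    solutions in c, which solve a linear scheme with nearby coefficients, shows
    that the difference quotients of the effective Hamiltonian at a common point
    differ by O(|y - x| + |z - x|) ([effective_three_point]), which yields a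
    Lipschitz derivative ([C1_on_three_point]).

    Convergence is a doubling-of-variables argument with penalty |z - y|^2/(2 e) and
    e = sqrt dx, done once for v - V and once for V - v. The penalty gradient is
    the same at the grid and at the continuum point, so both equations are tested at
    the same slope p, and the consistency errors are O(e) + O(dx/e). The discrete
    test needs monotonicity at p. For v - V the tangent inequality at DV supplies
    it ([touching_below]); for V - v the slope p lies between two actual slopes of V
    up to O(e), so the CFL bound is exceeded by O(e) only, which costs O(e) again
    ([touching_above]). Superlinear growth turns the CFL bound into a bound on the
    slopes of V that does not depend on the mesh ([H_p_coercive]), and this makes
    all constants uniform ([effective_error]). *)

(** * Hamiltonians as functions of a point of R^3 *)

Section slices.
Context {R : realType}.
Implicit Types G : R -> R -> R -> R.

Definition on_R3 G (z : R * R * R) : R := G z.1.1 z.1.2 z.2.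

Lemma on_R3_dir_p G x t p :
  (fun h : R => h^-1 *: ((on_R3 G \o shift ((x, t), p)) (h *: ((0, 0), 1)) - on_R3 G ((x, t), p)))
  = (fun h : R => h^-1 *: ((G x t \o shift p) (h *: 1) - G x t p)).
Proof. by apply/funext => h; rewrite /on_R3 /= !scaler0 !add0r. Qed.

Lemma on_R3_dir_x G x t p :
  (fun h : R => h^-1 *: ((on_R3 G \o shift ((x, t), p)) (h *: ((1, 0), 0)) - on_R3 G ((x, t), p)))
  = (fun h : R => h^-1 *: (((fun y => G y t p) \o shift x) (h *: 1) - G x t p)).
Proof. by apply/funext => h; rewrite /on_R3 /= !scaler0 !add0r. Qed.

Lemma on_R3_dir_t G x t p :
  (fun h : R => h^-1 *: ((on_R3 G \o shift ((x, t), p)) (h *: ((0, 1), 0)) - on_R3 G ((x, t), p)))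
  = (fun h : R => h^-1 *: (((fun s => G x s p) \o shift t) (h *: 1) - G x t p)).
Proof. by apply/funext => h; rewrite /on_R3 /= !scaler0 !add0r. Qed.

Lemma derive_p_slice G x t p :
  'D_((0, 0), 1) (on_R3 G) ((x, t), p) = 'D_1 (G x t) p.
Proof. by rewrite /derive on_R3_dir_p. Qed.
Lemma derive_x_slice G x t p :
  'D_((1, 0), 0) (on_R3 G) ((x, t), p) = 'D_1 (fun y => G y t p) x.
Proof. by rewrite /derive on_R3_dir_x. Qed.
Lemma derive_t_slice G x t p :
  'D_((0, 1), 0) (on_R3 G) ((x, t), p) = 'D_1 (fun s => G x s p) t.
Proof. by rewrite /derive on_R3_dir_t. Qed.

Lemma derivable_p_slice G x t p :
  derivable (on_R3 G) ((x, t), p) ((0, 0), 1) -> derivable (G x t) p 1.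
Proof. by rewrite /derivable on_R3_dir_p. Qed.
Lemma derivable_x_slice G x t p :
  derivable (on_R3 G) ((x, t), p) ((1, 0), 0) -> derivable (fun y => G y t p) x 1.
Proof. by rewrite /derivable on_R3_dir_x. Qed.
Lemma derivable_t_slice G x t p :
  derivable (on_R3 G) ((x, t), p) ((0, 1), 0) -> derivable (fun s => G x s p) t 1.
Proof. by rewrite /derivable on_R3_dir_t. Qed.
End slices.

Section strip.
Context {R : realType}.
Implicit Types G : R -> R -> R -> R.

Definition torus_periodic G :=
  (forall x t p, G (x + 1) t p = G x t p) /\ (forall x t p, G x (t + 1) p = G x t p).

Lemma periodic_frac (g : R -> R) (x : R) : periodic g 1 -> g (x - (Num.floor x)%:~R) = g x.
Proof.
move=> gP; case: (Num.floor x) => n.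
  by rewrite -[in RHS](subrK n%:~R x) -[n%:~R]/(1 *+ n) (periodicn gP).
by rewrite NegzE intrN opprK -[n.+1%:~R]/(1 *+ n.+1) (periodicn gP).
Qed.

Lemma frac_itv01 (y : R) : 0 <= y - (Num.floor y)%:~R <= 1.
Proof.
by have /andP[] := floor_itv y; rewrite intrD /= => h1 h2; apply/andP; split; lra.
Qed.

(** By periodicity only the compact box [0, 1]^2 x [-M, M] matters. *)
Lemma strip_bounded G (M : R) : torus_periodic G -> continuous (on_R3 G) ->
  exists2 B, 0 < B & forall x t p, `|p| <= M -> `|G x t p| <= B.
Proof.
move=> [Gx Gt] Gc.
have [M0|M0] := leP 0 M; last first.
  by exists 1 => // x t p pM; have := le_lt_trans pM M0; rewrite normr_lt0.
pose A := (`[0, 1]%classic `*` `[0, 1]%classic) `*` `[- M, M]%classic : set (R * R * R).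
have A0 : A !=set0.
  by exists ((0, 0), 0); do 2?split; rewrite /= in_itv /= ?lexx ?ler01 // oppr_le0 M0.
have cA : compact A by do 2?apply: compact_setX; exact: segment_compact.
have cf : {within A, continuous (fun z => `|on_R3 G z|)}.
  apply: continuous_subspaceT => z.
  by apply: continuous_comp; [exact: Gc | exact: norm_continuous].
have [z _ zmax] := compact_EVT_max A0 cA cf.
exists (`|on_R3 G z| + 1) => [|x t p pM]; first by rewrite ltr_wpDl.
have -> : G x t p = G (x - (Num.floor x)%:~R) (t - (Num.floor t)%:~R) p.
  rewrite (periodic_frac x (g := fun y => G y _ p)) => [|y]; last exact: Gx.
  by rewrite (periodic_frac t (g := fun s => G x s p)) => // s; exact: Gt.
rewrite -[leLHS]/(`|on_R3 G ((x - (Num.floor x)%:~R, t - (Num.floor t)%:~R), p)|).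
apply: le_trans (zmax _ _) _; last by rewrite lerDl.
by rewrite inE; do 2?split; rewrite /= in_itv /= ?frac_itv01 // -ler_norml.
Qed.

Lemma derive_shift (V : normedModType R) (f : V -> R) (e v z : V) :
  (forall y, f (y + e) = f y) -> 'D_v f (z + e) = 'D_v f z.
Proof.
move=> fe; rewrite /derive.
by under eq_fun do rewrite /= addrA !fe.
Qed.

Lemma torus_periodic_derive G (v : R * R * R) : torus_periodic G ->
  torus_periodic (fun x t p => 'D_v (on_R3 G) ((x, t), p)).
Proof.
move=> [Gx Gt]; split => x t p.
  have -> : ((x + 1, t), p) = ((x, t), p) + ((1, 0), 0) :> R * R * R.
    by apply/eqP; rewrite !xpair_eqE /= !addr0 !eqxx.
  by apply: derive_shift => -[[y s] q]; rewrite /on_R3 /= !addr0 Gx.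
have -> : ((x, t + 1), p) = ((x, t), p) + ((0, 1), 0) :> R * R * R.
  by apply/eqP; rewrite !xpair_eqE /= !addr0 !eqxx.
by apply: derive_shift => -[[y s] q]; rewrite /on_R3 /= !addr0 Gt.
Qed.

Lemma mvt_lipschitz (g : R -> R) (L a b : R) :
  (forall s, derivable g s 1) ->
  (forall s, Num.min a b <= s <= Num.max a b -> `|'D_1 g s| <= L) ->
  `|g b - g a| <= L * `|b - a|.
Proof.
move=> gd.
suff hw (u v : R) : u <= v -> (forall s, u <= s <= v -> `|'D_1 g s| <= L) ->
    `|g v - g u| <= L * `|v - u|.
  by have [ab|ba] := leP a b; [exact: hw | rewrite distrC [`|b - a|]distrC; exact/hw/ltW].
move=> uv gL.
have [||c] := @MVT_segment R g (fun s => 'D_1 g s) u v uv.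
- by move=> s _; apply: DeriveDef.
- by apply: derivable_within_continuous => s _; exact: gd.
rewrite in_itv /= => cuv ->; rewrite normrM ler_wpM2r //; exact: gL.
Qed.

(** Moves along the three coordinate axes one after another; each partial
    derivative is periodic and continuous, hence bounded on the strip. *)
Lemma strip_lipschitz G (M : R) : torus_periodic G -> Ck 1 (on_R3 G) ->
  exists2 L, 0 < L & forall x t p y s q, `|p| <= M -> `|q| <= M ->
    `|G x t p - G y s q| <= L * (`|x - y| + `|t - s| + `|p - q|).
Proof.
move=> GP [_ GC].
have dG v z : derivable (on_R3 G) z v by have [] := GC v.
have bnd v : exists2 B, 0 < B & forall x t p, `|p| <= M -> `|'D_v (on_R3 G) ((x, t), p)| <= B.
  apply: strip_bounded; first exact: torus_periodic_derive.
  have [_ [c _]] := GC v.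
  by have -> : on_R3 (fun x t p => 'D_v (on_R3 G) ((x, t), p)) = (fun z => 'D_v (on_R3 G) z)
    by apply/funext => -[[]].
have [B1 B10 hB1] := bnd ((1, 0), 0).
have [B2 B20 hB2] := bnd ((0, 1), 0).
have [B3 B30 hB3] := bnd ((0, 0), 1).
exists (B1 + B2 + B3) => [|x t p y s q pM qM]; first by rewrite !addr_gt0.
have e1 : `|G x t p - G y t p| <= B1 * `|x - y|.
  apply: (@mvt_lipschitz (fun x => G x t p)) => z.
    by apply: derivable_x_slice; exact: dG.
  by move=> _; rewrite -derive_x_slice; exact: hB1.
have e2 : `|G y t p - G y s p| <= B2 * `|t - s|.
  apply: (@mvt_lipschitz (fun t => G y t p)) => z.
    by apply: derivable_t_slice; exact: dG.
  by move=> _; rewrite -derive_t_slice; exact: hB2.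
have e3 : `|G y s p - G y s q| <= B3 * `|p - q|.
  apply: (@mvt_lipschitz (fun p => G y s p)) => z.
    by apply: derivable_p_slice; exact: dG.
  move=> /andP[z1 z2]; rewrite -derive_p_slice; apply: hB3.
  move: pM qM z1 z2; rewrite !ler_norml ge_min le_max => /andP[? ?] /andP[? ?].
  by move=> /orP[?|?] /orP[?|?]; apply/andP; split; lra.
have -> : G x t p - G y s q = (G x t p - G y t p) + (G y t p - G y s p) + (G y s p - G y s q).
  by ring.
apply: (le_trans (ler_normD _ _)); apply: (le_trans (lerD (ler_normD _ _) (lexx _))).
apply: le_trans (lerD (lerD e1 e2) e3) _.
have := normr_ge0 (x - y); have := normr_ge0 (t - s); have := normr_ge0 (p - q).
nra.
Qed.
End strip.

(** * Convexity and coercivity of the Hamiltonian *)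

Section convexity.
Context {R : realType} (H : R -> R -> R -> R) (H_ass : hamiltonian_assumptions H).

Lemma Ck_pred (V : normedModType R) n (f : V -> R) : Ck n.+1 f -> Ck n f.
Proof.
elim: n f => [|n IH] f [fc fD]; split => // v; have [dv Dv] := fD v.
by split => //; exact: IH.
Qed.

Lemma ham_torus_periodic : torus_periodic H.
Proof.
by split => x t p; [exact: (ham_periodic_x H_ass t p) | exact: (ham_periodic_t H_ass x p)].
Qed.

Lemma on_R3_H_p : on_R3 (H_p H) = (fun z => 'D_((0, 0), 1) (on_R3 H) z).
Proof.
by apply/funext => -[[x t] p]; rewrite derive_p_slice /on_R3 /= /H_p derive1E.
Qed.

Lemma H_p_torus_periodic : torus_periodic (H_p H).
Proof.
have [] := torus_periodic_derive ((0, 0), 1) ham_torus_periodic.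
have E x t p : H_p H x t p = 'D_((0, 0), 1) (on_R3 H) ((x, t), p).
  by rewrite -[LHS]/(on_R3 (H_p H) ((x, t), p)) on_R3_H_p.
by move=> Ex Et; split => x t p; rewrite !E.
Qed.

Lemma on_R3_C2 : Ck 2 (on_R3 H). Proof. exact: ham_C2 H_ass. Qed.

Lemma on_R3_H_p_C1 : Ck 1 (on_R3 (H_p H)).
Proof. by rewrite on_R3_H_p; have [_ /(_ ((0, 0), 1))[]] := on_R3_C2. Qed.

Lemma derivable_H_in_p x t p : derivable (H x t) p 1.
Proof. by apply: derivable_p_slice; have [_ /(_ ((0, 0), 1))[]] := on_R3_C2. Qed.

Lemma derivable_H_p_in_p x t p : derivable (H_p H x t) p 1.
Proof. by apply: derivable_p_slice; have [_ /(_ ((0, 0), 1))[]] := on_R3_H_p_C1. Qed.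

Lemma H_p_nondecreasing x t p q : p <= q -> H_p H x t p <= H_p H x t q.
Proof.
move=> pq.
have [||c _ e] := @MVT_segment R (H_p H x t) (fun s => 'D_1 (H_p H x t) s) p q pq.
- by move=> s _; apply: DeriveDef => //; exact: derivable_H_p_in_p.
- by apply: derivable_within_continuous => s _; exact: derivable_H_p_in_p.
rewrite -subr_ge0 e mulr_ge0 ?subr_ge0 //.
by rewrite -derive1E; apply: ltW; exact: (ham_convex H_ass).
Qed.

Lemma H_p_tangent x t p q : H x t p + H_p H x t p * (q - p) <= H x t q.
Proof.
have mvt a b : a <= b -> exists2 c, a <= c <= b & H x t b - H x t a = H_p H x t c * (b - a).
  move=> ab.
  have [||c] := @MVT_segment R (H x t) (H_p H x t) a b ab.
  - move=> s _; rewrite /H_p derive1E; apply: DeriveDef => //.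
    exact: derivable_H_in_p.
  - by apply: derivable_within_continuous => s _; exact: derivable_H_in_p.
  by rewrite in_itv /= => ? ?; exists c.
have [pq|/ltW qp] := leP p q.
  have [c /andP[pc _] e] := mvt _ _ pq.
  have : H_p H x t p * (q - p) <= H_p H x t c * (q - p).
    by rewrite ler_wpM2r ?subr_ge0 //; exact: H_p_nondecreasing.
  by rewrite -e; lra.
have [c /andP[_ cp] e] := mvt _ _ qp.
have : H_p H x t c * (p - q) <= H_p H x t p * (p - q).
  by rewrite ler_wpM2r ?subr_ge0 //; exact: H_p_nondecreasing.
rewrite -e; lra.
Qed.

(** The secant slope of a convex function lies between the derivatives at the two
    ends; this is what transfers the CFL bound from solutions to differences of
    solutions. At q = p the slope is taken to be the derivative. *)
Lemma H_secant x t p q : exists s,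
  [/\ H x t q - H x t p = s * (q - p),
      `|s - H_p H x t p| <= `|H_p H x t q - H_p H x t p| &
      forall B, `|H_p H x t p| <= B -> `|H_p H x t q| <= B -> `|s| <= B].
Proof.
have [->|pq] := eqVneq q p.
  by exists (H_p H x t p); rewrite !subrr mulr0 normr0; split.
have t1 := H_p_tangent x t p q; have t2 := H_p_tangent x t q p.
have qp0 : q - p != 0 by rewrite subr_eq0.
pose s := (H x t q - H x t p) / (q - p).
have e : H x t q - H x t p = s * (q - p) by rewrite divfK.
exists s.
have : (H_p H x t p <= s <= H_p H x t q) \/ (H_p H x t q <= s <= H_p H x t p).
  have [lt_pq|lt_qp|/eqP] := ltgtP p q; last by rewrite eq_sym (negbTE pq).
  - have d : 0 < q - p by rewrite subr_gt0.
    by left; apply/andP; split; rewrite -(ler_pM2r d) -e; lra.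
  - have d : 0 < p - q by rewrite subr_gt0.
    by right; apply/andP; split; rewrite -(ler_pM2r d); move: e; lra.
move=> hs; split => //.
  case: hs => /andP[h1 h2].
    by rewrite ger0_norm ?subr_ge0 // ger0_norm ?subr_ge0 ?(le_trans h1) // lerD2r.
  by rewrite ler0_norm ?subr_le0 // ler0_norm ?subr_le0 ?(le_trans h1) // lerN2 lerD2r.
move=> B; rewrite !ler_norml => /andP[? ?] /andP[? ?].
by case: hs => /andP[? ?]; apply/andP; split; lra.
Qed.

End convexity.

Section coercivity.
Context {R : realType} (H : R -> R -> R -> R) (H_ass : hamiltonian_assumptions H).

(** The sign s treats the two directions p -> +oo and p -> -oo at once. *)
Lemma superlinear_dir (s : R) x t A : s = 1 \/ s = -1 ->
  exists2 P, 0 < P & A * P < H x t (s * P) - H x t 0.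
Proof.
move=> s1.
have [hp hm] := ham_superlinear H_ass x t.
have [M hM] : exists M : R, forall P, 0 < P -> M < P -> (A + 1) * P <= H x t (s * P).
  case: s1 => ->.
    have [M [_ hM]] := (cvgryPge _).1 hp (A + 1).
    exists M => P P0 MP; have := hM P MP.
    by rewrite gtr0_norm // ler_pdivlMr // mul1r.
  have [M [_ hM]] := (cvgryPge _).1 hm (A + 1).
  exists (- M) => P P0 MP; have := hM (- P); rewrite ltrNl => /(_ MP).
  by rewrite normrN gtr0_norm // ler_pdivlMr // mulN1r.
pose P := `|M| + `|H x t 0| + 1.
have P0 : 0 < P by rewrite ltr_wpDl // addr_ge0.
exists P => //.
have := hM P P0; rewrite mulrDl mul1r {1 3}/P.
have := ler_norm M; have := normr_ge0 M; have := ler_norm (H x t 0); have := normr_ge0 (H x t 0).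
lra.
Qed.

(** Superlinearity is assumed only pointwise in (x, t). It gives one P at which the
    increment H(P) - H(0) beats A P, an open condition in (x, t), and the tangent
    inequality together with monotonicity of H_p propagates it to every larger p;
    compactness of the torus then makes P uniform. *)
Lemma H_p_large (s A : R) : s = 1 \/ s = -1 ->
  exists2 M, 0 < M & forall x t p, M <= p -> A < s * H_p H x t (s * p).
Proof.
move=> s1.
have ss : s * s = 1 by case: s1 => ->; rewrite ?mulr1 // mulrNN mulr1.
have mono x t p q : p <= q -> s * H_p H x t (s * p) <= s * H_p H x t (s * q).
  move=> pq; case: s1 => ->; rewrite ?mul1r ?mulN1r ?lerN2;
    apply: H_p_nondecreasing => //; by rewrite lerN2.
pose K := `[0, 1]%classic `*` `[0, 1]%classic : set (R * R).
have cK : near_covering K.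
  by apply/compact_near_coveringP/compact_setX; exact: segment_compact.
have Hc p : continuous (fun z : R * R => H z.1 z.2 p).
  have -> : (fun z : R * R => H z.1 z.2 p) = on_R3 H \o (fun z => (z, p)).
    by apply/funext => -[].
  move=> z; apply: continuous_comp; last by have [Hc _] := on_R3_C2 H_ass; exact: Hc.
  by apply: (cvg_pair (F := nbhs z) (G := nbhs z) (H := nbhs p)); [exact: cvg_id | exact: cvg_cst].
have := cK R +oo (fun p (z : R * R) => A < s * H_p H z.1 z.2 (s * p)) _.
case=> [[x t] _|M [_ hM]].
  have [P P0 hP] := superlinear_dir x t A s1.
  exists ([set z | A * P < H z.1 z.2 (s * P) - H z.1 z.2 0], [set p | P <= p]).
    split => /=; last by apply: nbhs_pinfty_ge; exact: num_real.
    apply: (@cvgr_gt _ _ (nbhs (x, t)) _ (fun z : R * R => H z.1 z.2 (s * P) - H z.1 z.2 0)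
      (H x t (s * P) - H x t 0)) => //.
    exact: (cvgB (Hc (s * P) (x, t)) (Hc 0 (x, t))).
  move=> [z p] /= [hz Pp]; apply: lt_le_trans (mono _ _ _ _ Pp).
  have := H_p_tangent H_ass z.1 z.2 (s * P) 0.
  rewrite sub0r mulrN => ht.
  rewrite -(ltr_pM2r P0); apply: lt_le_trans hz _.
  have -> : s * H_p H z.1 z.2 (s * P) * P = H_p H z.1 z.2 (s * P) * (s * P) by ring.
  lra.
have [Px Pt] := H_p_torus_periodic H_ass.
exists (`|M| + 1) => [|x t p Mp]; first by rewrite ltr_wpDl.
have Mp' : M < p by apply: lt_le_trans Mp; have := ler_norm M; lra.
have -> : H_p H x t (s * p) = H_p H (x - (Num.floor x)%:~R) (t - (Num.floor t)%:~R) (s * p).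
  rewrite (periodic_frac x (g := fun y => H_p H y _ _)) => [|y]; last exact: Px.
  by rewrite (periodic_frac t (g := fun s' => H_p H x s' _)) => // r; exact: Pt.
apply: (hM p Mp' (_, _)).
by split; rewrite /= in_itv /= frac_itv01.
Qed.

(** Turns the CFL bound on H_p into a bound on slopes uniform in the mesh. *)
Lemma H_p_coercive (A : R) :
  exists2 M, 0 < M & forall x t p, `|H_p H x t p| <= A -> `|p| <= M.
Proof.
have [M1 M10 h1] := @H_p_large 1 A (or_introl erefl).
have [M2 M20 h2] := @H_p_large (-1) A (or_intror erefl).
exists (M1 + M2) => [|x t p]; first by rewrite addr_gt0.
rewrite !ler_norml => /andP[hA1 hA2].
apply/andP; split; rewrite leNgt; apply/negP => hp.
  have := h2 x t (- p); rewrite !mulN1r opprK => h.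
  have /h : M2 <= - p by lra.
  lra.
have := h1 x t p; rewrite !mul1r => h.
have /h : M1 <= p by lra.
lra.
Qed.
End coercivity.

(** * The periodic grid *)

Section grid.
Context {R : realType}.
Implicit Types (N K k : nat) (m n : int).

Lemma even_pred_succ k m : even_node k m ->
  ~~ even_node k (m - 1) /\ ~~ even_node k (m + 1).
Proof. by rewrite /even_node; lia. Qed.

Lemma even_node_S k m : ~~ even_node k.+1 m = even_node k m.
Proof. by rewrite /even_node; lia. Qed.

Lemma even_node_period N k m : even_node k (m + (2 * N)%N%:Z) = even_node k m.
Proof. by rewrite /even_node; lia. Qed.

Lemma even_node_time_period K k m : even_node (k + 2 * K)%N m = even_node k m.
Proof. by rewrite /even_node; lia. Qed.

Lemma dx_gt0 N : (0 < N)%N -> 0 < dx N :> R.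
Proof. by move=> N0; rewrite invr_gt0 mulr_gt0 // ltr0n. Qed.

Lemma dt_gt0 K : (0 < K)%N -> 0 < dt K :> R.
Proof. exact: dx_gt0. Qed.

Lemma dxM N : (0 < N)%N -> (2 * N)%:R * dx N = 1 :> R.
Proof. by move=> N0; rewrite natrM /dx divff // mulf_neq0 ?pnatr_eq0 // -lt0n. Qed.

Lemma dtM K : (0 < K)%N -> (2 * K)%:R * dt K = 1 :> R.
Proof. exact: dxM. Qed.

Lemma xgD N m n : xg N (m + n) = xg N m + n%:~R * dx N :> R.
Proof. by rewrite /xg intrD mulrDl. Qed.

Lemma xgD1 N m : xg N (m + 1) = xg N m + dx N :> R.
Proof. by rewrite xgD mul1r. Qed.

Lemma xgB1 N m : xg N (m - 1) = xg N m - dx N :> R.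
Proof. by rewrite xgD intrN mulN1r. Qed.

Lemma xg_period N m : (0 < N)%N -> xg N (m + (2 * N)%N%:Z) = xg N m + 1 :> R.
Proof. by move=> N0; rewrite xgD -[_%:~R]/((2 * N)%:R) dxM. Qed.

Lemma tgS K k : tg K k.+1 = tg K k + dt K :> R.
Proof. by rewrite /tg -addn1 natrD mulrDl mul1r. Qed.

Lemma tg_period K k : (0 < K)%N -> tg K (k + 2 * K)%N = tg K k + 1 :> R.
Proof. by move=> K0; rewrite /tg natrD mulrDl dtM. Qed.

Lemma center_unique N k m (x : R) : (0 < N)%N -> even_node k m ->
  xg N (m - 1) <= x < xg N (m + 1) -> Defs.center N k x = m.
Proof.
move=> N0 em /andP[x1 x2]; have d0 := dx_gt0 N0.
have /andP[y1 y2] := center_cell k x N0; have ec := center_even N k x.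
have lt1 (a b : int) : xg N (a - 1) <= x -> x < xg N (b + 1) -> (a - 1 < b + 1)%R.
  move=> ha hb; have := le_lt_trans ha hb.
  by rewrite /xg ltr_pM2r // ltr_int.
have := lt1 _ _ x1 y2; have := lt1 _ _ y1 x2.
move: em ec; rewrite /even_node; lia.
Qed.

Lemma center_node N k m : (0 < N)%N -> ~~ even_node k m ->
  Defs.center N k (xg N m : R) = m + 1.
Proof.
move=> N0 om; have d0 := dx_gt0 N0; apply: center_unique => //.
  by move: om; rewrite /even_node; lia.
by rewrite addrK lexx /= !xgD1; lra.
Qed.

(** A shift by 2 K levels is even, so the cells of time 1 are those of time 0. *)
Lemma center_time_period N K (x : R) : Defs.center N (2 * K)%N x = Defs.center N 0%N x.
Proof.
rewrite /Defs.center mulr0n subr0.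
have -> : (x / dx N - (2 * K)%:R + 1) / 2 = (x / dx N + 1) / 2 + (- K%:Z)%:~R :> R.
  rewrite natrM intrN -[K%:Z%:~R]/(K%:R); set y := x / dx N.
  by field.
by rewrite floorDrz ?intr_int // intrKfloor; set f := Num.floor _; lia.
Qed.

Lemma time_step_grid K k : (0 < K)%N -> time_step K (tg K k : R) = k.
Proof.
by move=> K0; rewrite /time_step /tg mulfK ?gt_eqF ?dt_gt0 // natrK.
Qed.

Lemma int_periodic (T : Type) (P : pred int) (s : int -> T) (p : nat) :
  (forall m, P (m + p%:Z) = P m) -> (forall m, P m -> s (m + p%:Z) = s m) ->
  forall z m, P m -> s (m + p%:Z * z) = s m.
Proof.
move=> hP hs; have pos (j : nat) m : P m -> s (m + p%:Z * j%:Z) = s m /\ P (m + p%:Z * j%:Z).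
  move=> Pm; elim: j => [|j [IH IH']]; first by rewrite mulr0 addr0.
  by rewrite -[j.+1]addn1 PoszD mulrDr mulr1 addrA hs // hP.
move=> [j|j] m Pm; first by have [] := pos j m Pm.
rewrite NegzE mulrN.
have Pm' : P (m - p%:Z * j.+1%:Z).
  elim: j.+1 => [|i IH]; first by rewrite mulr0 subr0.
  rewrite -hP; apply: etrans IH; congr P; rewrite -addn1 PoszD; ring.
by have [<- _] := pos j.+1 _ Pm'; rewrite subrK.
Qed.

Lemma level_bounded N (P : pred int) (s : int -> R) : (0 < N)%N ->
  (forall m, P (m + (2 * N)%N%:Z) = P m) ->
  (forall m, P m -> s (m + (2 * N)%N%:Z) = s m) ->
  exists2 B, 0 <= B & forall m, P m -> `|s m| <= B.
Proof.
move=> N0 hP hs.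
exists (\sum_(j < 2 * N) `|s j%:Z|) => [|m Pm]; first exact: sumr_ge0.
pose i := (m %% (2 * N)%N%:Z)%Z.
have i0 : 0 <= i < (2 * N)%N%:Z by rewrite /i; lia.
have mE : i + (2 * N)%N%:Z * (m %/ (2 * N)%N%:Z)%Z = m by rewrite /i; lia.
have Pi : P i.
  apply: etrans Pm; rewrite -[in RHS]mE; apply: esym.
  by apply: (@int_periodic bool xpredT P (2 * N)%N) => // *; exact: hP.
rewrite -mE (int_periodic hP hs) //.
case: i i0 {mE Pi} => // i /andP[_ i1].
by rewrite (bigD1 (Ordinal (i1 : (i < 2 * N)%N))) //= lerDl sumr_ge0.
Qed.

(** Being at a positive level k.+1, the maximizing node has predecessors, to which
    the scheme can be applied; the bound on k is needed to count the steps between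
    a maximum and a minimum. *)
Lemma grid_argmax N K (F : nat -> int -> R) : (0 < N)%N -> (0 < K)%N ->
  (forall k m, ~~ even_node k m -> F k (m + (2 * N)%N%:Z) = F k m) ->
  (forall k m, ~~ even_node k m -> F (k + 2 * K)%N m = F k m) ->
  exists k m, [/\ (k < 2 * K)%N, ~~ even_node k.+1 m &
    forall k' m', ~~ even_node k' m' -> F k' m' <= F k.+1 m].
Proof.
move=> N0 K0 Fx Ft.
have N20 : (0 < 2 * N)%N by rewrite muln_gt0.
have K20 : (0 < 2 * K)%N by rewrite muln_gt0.
pose P (q : 'I_(2 * K) * 'I_(2 * N)) := ~~ even_node q.1.+1 (q.2 : nat)%:Z.
pose G (q : 'I_(2 * K) * 'I_(2 * N)) := F q.1.+1 (q.2 : nat)%:Z.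
have P0 : P (Ordinal K20, Ordinal N20) by [].
have [[k m] /= Pkm hmax] := arg_maxP G P0.
exists k, (m : nat)%:Z; split => // k' m' o'.
have Fkk j l n : ~~ even_node l n -> F (l + 2 * K * j)%N n = F l n.
  move=> o; elim: j => [|j IH]; first by rewrite muln0 addn0.
  by rewrite mulnSr addnA Ft //; move: o; rewrite /even_node -mulnA; lia.
pose l := ((k' + 2 * K).-1 %% (2 * K))%N.
have kE : (k' + 2 * K)%N = (l.+1 + 2 * K * ((k' + 2 * K).-1 %/ (2 * K)))%N.
  rewrite /l addSn addnC [X in (X + _)%N]mulnC.
  by have := divn_eq (k' + 2 * K).-1 (2 * K); lia.
have ol : ~~ even_node l.+1 m'.
  by move: o' kE; rewrite /even_node -mulnA; lia.
rewrite -(Ft _ _ o') kE Fkk //.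
pose i := (m' %% (2 * N)%N%:Z)%Z.
have i0 : 0 <= i < (2 * N)%N%:Z by rewrite /i; lia.
have mE : i + (2 * N)%N%:Z * (m' %/ (2 * N)%N%:Z)%Z = m' by rewrite /i; lia.
have oi : ~~ even_node l.+1 i by move: ol; rewrite /even_node; lia.
rewrite -mE (@int_periodic _ (fun n => ~~ even_node l.+1 n) (F l.+1)) //; last 2 first.
- by move=> n; rewrite /even_node; lia.
- by move=> n; exact: Fx.
case: i i0 {mE} oi => // i /andP[_ i1] oi.
have l1 : (l < 2 * K)%N by rewrite ltn_mod.
exact: (hmax (Ordinal l1, Ordinal (i1 : (i < 2 * N)%N))).
Qed.
End grid.

(** * Step functions on the grid cells *)

Section step_functions.
Context {R : realType}.
Local Notation mu := (@lebesgue_measure R).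
Implicit Types (N k : nat) (m : int) (s : int -> R) (f : R -> R).

Definition step N s (x : R) : R := s (Defs.center N 0%N x).

Lemma step_cell N s m x : (0 < N)%N -> even_node 0 m ->
  xg N (m - 1) <= x < xg N (m + 1) -> step N s x = s m.
Proof. by move=> N0 em xm; rewrite /step (center_unique (x := x) N0 em). Qed.

Lemma measurable_step N s : (0 < N)%N -> measurable_fun [set: R] (step N s).
Proof.
move=> N0 _ Y mY; rewrite setTI.
have -> : step N s @^-1` Y = \bigcup_(m : int)
    (if even_node 0 m && (s m \in Y) then `[xg N (m - 1), xg N (m + 1)[%classic else set0).
  apply/seteqP; split => [x Yx|x [m _]].
    exists (Defs.center N 0%N x) => //; rewrite center_even /=.
    by rewrite mem_set //= in_itv /=; exact: center_cell.
  case: ifPn => // /andP[em /set_mem sm] /=; rewrite in_itv /= => xm.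
  by rewrite /preimage /= (step_cell s N0 em xm).
apply: countable_bigcupT_measurable => // m.
by case: ifP.
Qed.

Lemma step_periodic N s : (0 < N)%N ->
  (forall m, even_node 0 m -> s (m + (2 * N)%N%:Z) = s m) -> periodic (step N s) 1.
Proof.
move=> N0 hs x; have ec := center_even N 0 x.
have ec' : even_node 0 (Defs.center N 0%N x + (2 * N)%N%:Z).
  by move: ec; rewrite /even_node; lia.
rewrite [RHS]/step -hs // (step_cell s N0 ec') //.
have := center_cell 0 x N0; set m := Defs.center _ _ _.
have -> : m + (2 * N)%N%:Z - 1 = (m - 1) + (2 * N)%N%:Z by ring.
have -> : m + (2 * N)%N%:Z + 1 = (m + 1) + (2 * N)%N%:Z by ring.
by rewrite !(xg_period _ N0) lerD2r ltrD2r.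
Qed.

Lemma ae_sub (P Q : R -> Prop) : (forall x, P x -> Q x) ->
  {ae mu, forall x, P x} -> {ae mu, forall x, Q x}.
Proof. by move=> PQ; exact: (@filterS _ _ (ae_filter_ringOfSetsType mu) _ _ PQ). Qed.

Lemma Rintegral_ae_const f (a b c : R) : a <= b -> measurable_fun [set: R] f ->
  {ae mu, forall x, a <= x < b -> f x = c} ->
  \int[mu]_(x in `[a, b]) f x = (b - a) * c.
Proof.
move=> ab mf fc.
have mf' : measurable_fun `[a, b[%classic (EFin \o f).
  by apply/measurable_EFinP; exact: measurable_funTS.
rewrite /Rintegral -integral_itv_bndo_bndc //.
rewrite (@ae_eq_integral _ _ _ _ _ (cst c%:E)) //; last first.
  by apply: ae_sub fc => x hx; rewrite /= in_itv /= => /hx ->.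
rewrite integral_cst //= lebesgue_measure_itv /= lte_fin.
by have [lt_ab|] := ltP a b; [rewrite -EFinD -EFinM /= mulrC|
  move=> ba; rewrite mule0 /= (@le_anti _ _ a b) ?ab // subrr mul0r].
Qed.

Lemma cell_integral N s f m : (0 < N)%N -> measurable_fun [set: R] f ->
  {ae mu, forall x, step N s x = f x} -> even_node 0 m ->
  \int[mu]_(x in `[xg N m - dx N, xg N m + dx N]) f x = 2 * dx N * s m.
Proof.
move=> N0 mf sf em; have d0 : 0 < dx N :> R := dx_gt0 N0.
rewrite (@Rintegral_ae_const f _ _ (s m)) //; first by congr (_ * _); ring.
  by lra.
apply: ae_sub sf => x <- xm; apply: step_cell => //.
by rewrite xgB1 xgD1.
Qed.

(** The cells are centred at even multiples of dx, so the ends 0 and 1 cut a cell in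
    half; the two halves carry the same value by periodicity. *)
Lemma unit_integral N s f : (0 < N)%N -> measurable_fun [set: R] f ->
  (forall m, even_node 0 m -> s (m + (2 * N)%N%:Z) = s m) ->
  {ae mu, forall x, step N s x = f x} ->
  \int[mu]_(x in `[0, 1]) f x = 2 * dx N * \sum_(i < N) s (2 * i%:Z).
Proof.
move=> N0 mf sP sf; have d0 : 0 < dx N :> R := dx_gt0 N0.
have mS := measurable_step s N0.
have -> : \int[mu]_(x in `[0, 1]) f x = \int[mu]_(x in `[0, 1]) step N s x.
  rewrite /Rintegral; congr fine; apply: ae_eq_integral => //.
  - by apply/measurable_EFinP; exact: measurable_funTS.
  - by apply/measurable_EFinP; exact: measurable_funTS.
  - by apply: ae_sub sf => x -> _.
have eP m : even_node 0 (m + (2 * N)%N%:Z) = even_node 0 m by rewrite /even_node; lia.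
have [B B0 sB] := level_bounded N0 eP sP.
have iS (a b : R) : mu.-integrable `[a, b]%classic (EFin \o step N s).
  apply: measurable_bounded_integrable => //.
  - suff : (lebesgue_measure (`[a, b]%classic : set R) < +oo)%E by [].
    by rewrite lebesgue_measure_itv /=; case: ifP => // _; rewrite -EFinD ltry.
  - exact: measurable_funTS.
  - exists B; split; first exact: num_real.
    move=> y By x _ /=; apply: le_trans (ltW By); apply: sB; exact: center_even.
(* c j is the even center of the cell that contains the j-th half cell. *)
pose c (j : nat) : int := (j + odd j)%N.
have seg (n : nat) : \int[mu]_(x in `[0, n%:R * dx N]) step N s x = dx N * \sum_(j < n) s (c j).
  elim: n => [|n IH].
    by rewrite big_ord0 mulr0 (@Rintegral_ae_const _ _ _ 0) ?mul0r ?mulr0 //;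
      apply: aeW => x /andP[? ?]; lra.
  have n0 : 0 <= n%:R :> R by [].
  have nS : n.+1%:R * dx N = n%:R * dx N + dx N :> R by rewrite -addn1 natrD mulrDl mul1r.
  have nd0 : 0 <= n%:R * dx N :> R by rewrite mulr_ge0 // ltW.
  rewrite big_ord_recr mulrDr -IH /=; apply/eqP; rewrite addrC -subr_eq; apply/eqP.
  have nle : n%:R * dx N <= n.+1%:R * dx N :> R by rewrite nS lerDl ltW.
  rewrite Rintegral_itvB ?bnd_simp //.
  rewrite Rintegral_itv_obnd_cbnd; last first.
    apply: integrableS (iS 0 (n.+1%:R * dx N)) => //.
    by apply: subset_itvr; rewrite bnd_simp.
  rewrite (Rintegral_ae_const (c := s (c n)) nle) //.
    by rewrite [in LHS]nS addrAC subrr add0r.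
  apply: aeW => x /andP[x1 x2]; apply: step_cell => //; first by rewrite /even_node /c; lia.
  rewrite xgB1 xgD1 /c /xg; move: x1 x2; rewrite nS; case: (odd n) => /=.
    by rewrite addn1 -[n.+1%:Z%:~R]/(n.+1%:R) nS => ? ?; apply/andP; split; lra.
  by rewrite addn0 -[n%:Z%:~R]/(n%:R) => ? ?; apply/andP; split; lra.
have -> : `[0 : R, 1] = `[0, (2 * N)%:R * dx N] by rewrite dxM.
rewrite seg.
have tel (n : nat) : \sum_(j < 2 * n) s (c j) =
    2 * (\sum_(i < n) s (2 * i%:Z)) + s (2 * n%:Z) - s 0.
  elim: n => [|n IH]; first by rewrite !big_ord0 !mulr0 add0r subrr.
  have -> : (2 * n.+1 = (2 * n).+2)%N by lia.
  rewrite !big_ord_recr /= IH.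
  have -> : c (2 * n)%N = 2 * n%:Z by rewrite /c; lia.
  have -> : c (2 * n).+1 = 2 * n.+1%:Z by rewrite /c; lia.
  by ring.
rewrite tel; have -> : s (2 * N%:Z) = s 0.
  by rewrite -(sP 0) // add0r; congr s; lia.
by ring.
Qed.
End step_functions.

(** * From Hamilton-Jacobi to Lax-Friedrichs solutions *)

Section slopes.
Context {R : realType}.
Local Notation mu := (@lebesgue_measure R).
Implicit Types (H : R -> R -> R -> R) (N K k : nat) (m : int) (v : nat -> int -> R).

Lemma Lip_le (r : R) (v0 : R -> R) x y : Lip r v0 -> `|v0 x - v0 y| <= r * `|x - y|.
Proof. by move=> [_ /(_ (x, y))]; exact. Qed.

Lemma Lip_of_le (r : R) (v0 : R -> R) : periodic v0 1 ->
  (forall x y, `|v0 x - v0 y| <= r * `|x - y|) -> Lip r v0.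
Proof. by move=> vP vl; split => // -[x y] _; exact: vl. Qed.

Definition slope N v k m : R := (v k (m + 1) - v k (m - 1)) / (2 * dx N).

(** The scheme solved for the new time level. *)
Definition hj_equation H N K (c h : R) v : Prop := forall k m, even_node k m ->
  v k.+1 m = (v k (m - 1) + v k (m + 1)) / 2
    - dt K * (H (xg N m) (tg K k) (c + slope N v k m) - h).

Lemma hj_equationP H N K c h v : (0 < K)%N ->
  hj_equation H N K c h v <->
  (forall k m, even_node k m ->
    (v k.+1 m - (v k (m - 1) + v k (m + 1)) / 2) / dt K
    + H (xg N m) (tg K k) (c + (v k (m + 1) - v k (m - 1)) / (2 * dx N)) = h).
Proof.
move=> K0; have d0 := dt_gt0 K0 : 0 < dt K :> R.
have dn : dt K != 0 :> R by rewrite gt_eqF.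
split => hv k m em.
  rewrite hv // /slope; set a := _ / 2; set b := H _ _ _; by field.
rewrite /slope -(hv k m em); set a := _ / 2; set b := H _ _ _; by field.
Qed.

Lemma slope_lf_scheme H N K c h v : (0 < N)%N -> (0 < K)%N -> hj_equation H N K c h v ->
  forall k m, even_node k m ->
    (slope N v k.+1 (m + 1) - (slope N v k m + slope N v k (m + 2)) / 2) / dt K
    + (H (xg N (m + 2)) (tg K k) (c + slope N v k (m + 2))
       - H (xg N m) (tg K k) (c + slope N v k m)) / (2 * dx N) = 0.
Proof.
move=> N0 K0 hv k m em.
have dn : dt K != 0 :> R by rewrite gt_eqF // dt_gt0.
have dxn : dx N != 0 :> R by rewrite gt_eqF // dx_gt0.
have em2 : even_node k (m + 2) by move: em; rewrite /even_node; lia.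
rewrite {1}/slope addrK -(addrA m 1 1) (hv _ _ em) (hv _ _ em2).
set X := H _ _ _; set Y := H _ _ _.
rewrite /slope -!(addrA m 2) (_ : 2 - 1 = 1 :> int) //.
set p := v k (m + 1); set q := v k (m - 1); set s := v k (m + (2 + 1)).
by field; rewrite dn dxn.
Qed.

Definition space_periodic N v := forall k m, ~~ even_node k m ->
  v k (m + (2 * N)%N%:Z) = v k m.

Definition time_periodic K v := forall k m, ~~ even_node k m ->
  v (k + 2 * K)%N m = v k m.

Lemma slope_periodic N v : space_periodic N v -> forall k m, even_node k m ->
  slope N v k (m + (2 * N)%N%:Z) = slope N v k m.
Proof.
move=> vP k m em; rewrite /slope [m + _ + 1]addrAC [m + _ - 1]addrAC !vP //;
  by move: em; rewrite /even_node; lia.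
Qed.

Lemma sum_slope N v k : (0 < N)%N -> space_periodic N v -> even_node k 0 ->
  2 * dx N * (\sum_(i < N) slope N v k (2 * i%:Z)) = 0.
Proof.
move=> N0 vP ek; have dxn : dx N != 0 :> R by rewrite gt_eqF // dx_gt0.
have tel (n : nat) : 2 * dx N * (\sum_(i < n) slope N v k (2 * i%:Z)) =
    v k (2 * n%:Z - 1) - v k (-1).
  elim: n => [|n IH]; first by rewrite big_ord0 !mulr0 sub0r subrr.
  rewrite big_ord_recr /= mulrDr IH /slope.
  have -> : 2 * n.+1%:Z - 1 = 2 * n%:Z + 1 by lia.
  by field.
rewrite tel -(vP k (-1)); last by move: ek; rewrite /even_node; lia.
by rewrite (_ : -1 + (2 * N)%N%:Z = 2 * N%:Z - 1) ?subrr //; lia.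
Qed.

Lemma Linf_norm_le (f : R -> R) (r : R) : 0 <= r -> (forall x, `|f x| <= r) ->
  (Linf_norm f <= r%:E)%E.
Proof.
move=> r0 fr; rewrite /Linf_norm unlock; case: ifP => _; last by rewrite lee_fin.
by apply/ess_supP; apply: aeW => x /=; rewrite lee_fin.
Qed.

(** The initial datum is the step function of the initial slopes, not the
    derivative of v0: only cell averages enter the scheme. *)
Lemma hj_slope_lf_solution H N K c h r (v0 : R -> R) v : (0 < N)%N -> (0 < K)%N -> 0 <= r ->
  hj_solution H N K c h r v0 v ->
  exists2 u0, Linf0 r u0 & lf_solution H N K c u0 (slope N v).
Proof.
move=> N0 K0 r0 hv; have d0 : 0 < dx N :> R := dx_gt0 N0.
have vE : hj_equation H N K c h v by apply/hj_equationP => //; exact: hj_scheme hv.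
have sP := slope_periodic (hj_periodic hv).
have mS := measurable_step (slope N v 0) N0.
have aeS : {ae mu, forall x, step N (slope N v 0) x = step N (slope N v 0) x}.
  exact: aeW.
exists (step N (slope N v 0)); split => //.
- exact: step_periodic (sP 0%N).
- apply: Linf_norm_le => // x; rewrite /step.
  have := center_even N 0 x; set m := Defs.center _ _ _ => em.
  have e1 : v 0%N (m + 1) = v0 (xg N (m + 1)) by apply: (hj_initial hv).
  have e2 : v 0%N (m - 1) = v0 (xg N (m - 1)).
    rewrite -(subrK 1 (m - 1)) -(addrA m); apply: (hj_initial hv).
    by move: em; rewrite /even_node; lia.
  rewrite /slope e1 e2 normrM normfV ler_pdivrMr ?normr_gt0 ?mulf_neq0 ?gt_eqF //.
  apply: le_trans (Lip_le _ _ (hj_lip hv)) _; rewrite ler_wpM2l //.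
  by rewrite xgD1 xgB1 (_ : _ - _ = 2 * dx N) //; ring.
- by rewrite (unit_integral N0 mS (sP 0%N) aeS); apply: sum_slope => //; exact: hj_periodic hv.
- exact: slope_lf_scheme vE.
- move=> m em; rewrite (cell_integral N0 mS aeS em) mulKf //.
  by rewrite mulf_neq0 // gt_eqF.
Qed.
End slopes.

(** * The discrete maximum principle *)

Section maximum_principle.
Context {R : realType} (N K : nat) (N0 : (0 < N)%N) (NK : (N <= K)%N) (B : R)
  (cfl1 : B * (dt K / dx N) < 1).
Implicit Types (F : nat -> int -> R) (E : R).

Let K0 : (0 < K)%N := leq_trans N0 NK.
Let dx0 : 0 < dx N :> R := dx_gt0 N0.
Let dt0 : 0 < dt K :> R := dt_gt0 K0.
Let lam : R := dt K / dx N.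

(** The inequality satisfied by the difference of two solutions: s is a secant slope
    of H and E bounds the source. *)
Definition upwind_subsolution E F : Prop := forall k m, even_node k m ->
  exists2 s, `|s| <= B & F k.+1 m <= (F k (m - 1) + F k (m + 1)) / 2
    - dt K * (s * slope N F k m) + dt K * E.

(** The averaging step is a convex combination of a and b with weights
    (1 + s lam)/2 and (1 - s lam)/2, each at least (1 - B lam)/2. *)
Lemma upwind_weights (s a b M : R) : `|s| <= B -> a <= M -> b <= M ->
  (1 - B * lam) / 2 * (M - a) <= M - ((a + b) / 2 - dt K * (s * ((b - a) / (2 * dx N)))) /\
  (1 - B * lam) / 2 * (M - b) <= M - ((a + b) / 2 - dt K * (s * ((b - a) / (2 * dx N)))).
Proof.
move=> sB aM bM; have dxn : dx N != 0 :> R by rewrite gt_eqF.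
have lam0 : 0 < lam by rewrite divr_gt0.
have : `|s * lam| <= B * lam by rewrite normrM (gtr0_norm lam0) ler_wpM2r // ltW.
rewrite ler_norml => /andP[s1 s2].
have -> : M - ((a + b) / 2 - dt K * (s * ((b - a) / (2 * dx N)))) =
    (1 + s * lam) / 2 * (M - a) + (1 - s * lam) / 2 * (M - b) by rewrite /lam; field.
move: cfl1; rewrite -/lam => cfl; move: (B * lam) (s * lam) cfl s1 s2 => x y x1 s1 s2.
have Ma : 0 <= M - a by rewrite subr_ge0.
have Mb : 0 <= M - b by rewrite subr_ge0.
by split; nra.
Qed.

Lemma upwind_le (s a b M : R) : `|s| <= B -> a <= M -> b <= M ->
  (a + b) / 2 - dt K * (s * ((b - a) / (2 * dx N))) <= M.
Proof.
move=> sB aM bM; have [h _] := upwind_weights sB aM bM.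
rewrite -subr_ge0; apply: le_trans h; rewrite mulr_ge0 ?subr_ge0 //.
by rewrite divr_ge0 // subr_ge0 ltW.
Qed.

(** At a maximal node the averaging step cannot exceed the maximum, so the value
    there is reached only with the help of a nonnegative source. *)
Lemma maximum_principle E F : space_periodic N F -> time_periodic K F ->
  upwind_subsolution E F -> 0 <= E.
Proof.
move=> Fx Ft FE; have [k [m [_ om Fmax]]] := grid_argmax N0 K0 Fx Ft.
have em : even_node k m by rewrite -even_node_S.
have [s sB hF] := FE _ _ em.
have [nd1 nd2] := even_pred_succ em.
have := upwind_le sB (Fmax _ _ nd1) (Fmax _ _ nd2); rewrite -/(slope N F k m) => h.
by rewrite -(pmulr_rge0 _ dt0); lra.
Qed.

Fixpoint cone_deficit (j : nat) : R :=
  if j is i.+1 then (cone_deficit i + dt K) / ((1 - B * lam) / 2) else 0.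

Lemma cone_deficit_le i j : 0 <= B -> (i <= j)%N ->
  0 <= cone_deficit i <= cone_deficit j.
Proof.
move=> B0; have lam0 : 0 < lam by rewrite divr_gt0.
have BL : 0 <= B * lam by rewrite mulr_ge0 // ltW.
have rho : 0 < (1 - B * lam) / 2 by rewrite divr_gt0 // subr_gt0.
have D0 n : 0 <= cone_deficit n.
  by elim: n => //= n IH; rewrite divr_ge0 ?addr_ge0 // ltW.
have DS n : cone_deficit n <= cone_deficit n.+1.
  rewrite /= ler_pdivlMr //; have := D0 n; have := dt0; nra.
move=> ij; rewrite D0 /=; elim: j ij => [|j IH]; first by rewrite leqn0 => /eqP->.
by rewrite leq_eqVlt => /predU1P[->//|/IH /le_trans]; exact.
Qed.

(** Strong maximum principle with constants. Going back one time level from a node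
    that is below the maximum by d, both neighbours are below it by at most
    (d + dt E)/rho with rho = (1 - B lam)/2. After N levels this backward cone
    covers a whole spatial period, and time periodicity lets the maximum be placed
    far enough above the minimum. *)
Lemma oscillation_le E F k m k' m' : 0 <= B ->
  space_periodic N F -> time_periodic K F -> upwind_subsolution E F ->
  ~~ even_node k m -> ~~ even_node k' m' ->
  F k m - F k' m' <= cone_deficit (6 * K) * E.
Proof.
move=> B0 Fx Ft FE o o'.
have E0 := maximum_principle Fx Ft FE.
have rho : 0 < (1 - B * lam) / 2 by rewrite divr_gt0 // subr_gt0.
have [k1 [m1 [k1K om1 Fmax]]] := grid_argmax N0 K0 Fx Ft.
have NFx k0 m0 : ~~ even_node k0 m0 -> - F k0 (m0 + (2 * N)%N%:Z) = - F k0 m0.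
  by move=> ?; rewrite Fx.
have NFt k0 m0 : ~~ even_node k0 m0 -> - F (k0 + 2 * K)%N m0 = - F k0 m0.
  by move=> ?; rewrite Ft.
have [k2 [m2 [k2K om2 Fmin]]] := grid_argmax (F := fun k m => - F k m) N0 K0 NFx NFt.
apply: (@le_trans _ _ (F k1.+1 m1 - F k2.+1 m2)).
  by apply: lerB; [exact: Fmax | rewrite -lerN2; exact: Fmin].
set M := F k1.+1 m1 in Fmax *.
(* Two extra periods, so that at least N and at most 6 K levels lie in between. *)
pose top := (k1.+1 + 2 * K + 2 * K)%N.
have Ftop : F top m1 = M by rewrite /top !Ft // even_node_time_period.
have cone j : forall l i, (l + j)%N = top -> (i <= j)%N ->
    M - F l (m1 - j%:Z + 2 * i%:Z) <= cone_deficit j * E.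
  elim: j => [|j IH] l i.
    rewrite addn0 leqn0 => -> /eqP ->.
    by rewrite mulr0 addr0 subr0 Ftop subrr mul0r.
  move=> lj ij.
  have step i' : (i' <= j)%N -> forall n,
      (n = m1 - j%:Z + 2 * i'%:Z - 1 \/ n = m1 - j%:Z + 2 * i'%:Z + 1) ->
      M - F l n <= cone_deficit j.+1 * E.
    move=> ij' n; have := IH l.+1 i' _ ij'; rewrite addSnnS lj => /(_ erefl).
    have : even_node l (m1 - j%:Z + 2 * i'%:Z).
      by clear -om1 lj; move: om1 lj; rewrite /top /even_node; lia.
    move: (m1 - j%:Z + 2 * i'%:Z) => p ep hp hn.
    have [s sB hs] := FE l p ep.
    have [nd1 nd2] := even_pred_succ ep.
    have [w1 w2] := upwind_weights sB (Fmax _ _ nd1) (Fmax _ _ nd2).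
    rewrite -/(slope N F l p) in w1 w2.
    rewrite /= mulrAC ler_pdivlMr // mulrC.
    by case: hn => ->; move: hs hp w1 w2; rewrite /M; lra.
  case: (ltngtP i j.+1) ij => // [ij|->] _.
    by apply: (step i) => //; left; clear; lia.
  by apply: (step j) => //; right; clear; lia.
pose j := (top - k2.+1)%N.
have jl : (k2.+1 + j)%N = top by rewrite /j /top; clear -N0 NK k1K k2K; lia.
have jN : (N <= j)%N by rewrite /j /top; clear -N0 NK k1K k2K; lia.
have j6 : (j <= 6 * K)%N by rewrite /j /top; clear -N0 NK k1K k2K; lia.
have : exists i z, (i <= j)%N /\ m1 - j%:Z + 2 * i%:Z = m2 + (2 * N)%N%:Z * z.
  rewrite /top in jl; move: j jN j6 jl => j jN _ jl.
  clear -om1 om2 jl jN N0.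
  pose d : int := m2 - (m1 - j%:Z).
  (* The representative of m2 modulo 2 N in the window starting at m1 - j. *)
  exists `|divz (modz d (2 * N)%N%:Z) 2|%N, (- divz d (2 * N)%N%:Z).
  have hd := divz_eq d (2 * N)%N%:Z.
  have hm : 0 <= modz d (2 * N)%N%:Z < (2 * N)%N%:Z by lia.
  have d2 : (2 %| d)%Z by clear -om1 om2 jl; move: om1 om2 jl; rewrite /d /even_node; lia.
  move: hd hm d2; move: (divz d _) (modz d _) => q r hd hm d2.
  clear -hd hm d2 jN.
  have r2 : (2 %| r)%Z by lia.
  split; first by lia.
  by rewrite mulrN; move: hd; rewrite /d; lia.
case=> i [z [ij mE]].
have := cone j k2.+1 i jl ij; rewrite mE.
rewrite (@int_periodic _ (fun n => ~~ even_node k2.+1 n) (F k2.+1)) //; last 2 first.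
- by move=> n; rewrite even_node_period.
- by move=> n; exact: Fx.
move=> h; apply: le_trans h _; apply: ler_wpM2r => //.
by have /andP[] := cone_deficit_le B0 j6.
Qed.

End maximum_principle.

(** * Comparison and convexity of the effective Hamiltonian *)

Section discrete_effective.
Context {R : realType} (H : R -> R -> R -> R) (H_ass : hamiltonian_assumptions H).
Context (N K : nat) (N0 : (0 < N)%N) (NK : (N <= K)%N) (B : R)
  (cfl1 : B * (dt K / dx N) < 1).
Implicit Types (v w : nat -> int -> R) (c h : R).

Let K0 : (0 < K)%N := leq_trans N0 NK.
Let dx0 : 0 < dx N :> R := dx_gt0 N0.
Let dt0 : 0 < dt K :> R := dt_gt0 K0.

Definition cfl_bound c v : Prop := forall k m, even_node k m ->
  `|H_p H (xg N m) (tg K k) (c + slope N v k m)| <= B.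

Definition doubly_periodic v : Prop := space_periodic N v /\ time_periodic K v.

Lemma slopeB v w k m :
  slope N (fun k m => v k m - w k m) k m = slope N v k m - slope N w k m.
Proof. by rewrite /slope -mulrBl; congr (_ / _); ring. Qed.

Lemma slopeZ (a : R) v k m : slope N (fun k m => a * v k m) k m = a * slope N v k m.
Proof. by rewrite /slope mulrA -mulrBr. Qed.

Lemma doubly_periodicB v w : doubly_periodic v -> doubly_periodic w ->
  doubly_periodic (fun k m => v k m - w k m).
Proof. by move=> [vx vt] [wx wt]; split => k m o; rewrite ?vx ?wx ?vt ?wt. Qed.

Lemma doubly_periodicZ (a : R) v : doubly_periodic v ->
  doubly_periodic (fun k m => a * v k m).
Proof. by move=> [vx vt]; split => k m o; rewrite ?vx ?vt. Qed.

(** Comparison of effective values for a subsolution and a solution; the secant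
    slopes of H make their difference an upwind subsolution with source h - h'. *)
Lemma hj_compare c h h' v w : doubly_periodic v -> doubly_periodic w ->
  cfl_bound c v -> cfl_bound c w ->
  (forall k m, even_node k m -> v k.+1 m <= (v k (m - 1) + v k (m + 1)) / 2
    - dt K * (H (xg N m) (tg K k) (c + slope N v k m) - h)) ->
  hj_equation H N K c h' w -> h' <= h.
Proof.
move=> vP wP vB wB hv hw; rewrite -subr_ge0.
have [dP1 dP2] := doubly_periodicB vP wP.
apply: (maximum_principle N0 NK cfl1 dP1 dP2) => k m em.
have [s [se _ /(_ B) sB]] := H_secant H_ass (xg N m) (tg K k)
  (c + slope N w k m) (c + slope N v k m).
exists s; first by apply: sB; [exact: wB | exact: vB].
have e : c + slope N v k m - (c + slope N w k m) = slope N v k m - slope N w k m by ring.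
rewrite {}e in se.
rewrite slopeB -se hw //; apply: le_trans (lerB (hv _ _ em) (lexx _)) _.
by rewrite le_eqVlt; apply/orP; left; apply/eqP; field.
Qed.

Lemma hj_unique c h h' v w : doubly_periodic v -> doubly_periodic w ->
  cfl_bound c v -> cfl_bound c w ->
  hj_equation H N K c h v -> hj_equation H N K c h' w -> h = h'.
Proof.
move=> vP wP vB wB hv hw; apply: le_anti; apply/andP; split.
  by apply: (hj_compare wP vP wB vB _ hv) => k m em; rewrite hw.
by apply: (hj_compare vP wP vB wB _ hw) => k m em; rewrite hv.
Qed.

(** By convexity of H the combination of v and w is a subsolution, and it inherits
    the CFL bound because its slopes lie between those of v and w. *)
Lemma hj_convex (t a b ha hb hc : R) v w z : 0 <= t <= 1 ->
  doubly_periodic v -> doubly_periodic w -> doubly_periodic z ->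
  cfl_bound a v -> cfl_bound b w -> cfl_bound (t * a + (1 - t) * b) z ->
  hj_equation H N K a ha v -> hj_equation H N K b hb w ->
  hj_equation H N K (t * a + (1 - t) * b) hc z ->
  hc <= t * ha + (1 - t) * hb.
Proof.
move=> /andP[t0 t1] vP wP zP vB wB zB hv hw hz.
pose y k m := t * v k m - (t - 1) * w k m.
have yP : doubly_periodic y.
  by apply: doubly_periodicB; exact: doubly_periodicZ.
have slopey k m : t * a + (1 - t) * b + slope N y k m =
    t * (a + slope N v k m) + (1 - t) * (b + slope N w k m).
  by rewrite slopeB !slopeZ; ring.
apply: (hj_compare yP zP _ zB _ hz) => k m em; rewrite slopey.
  have mono p q : p <= q ->
      H_p H (xg N m) (tg K k) p <= H_p H (xg N m) (tg K k) q := @H_p_nondecreasing _ _ H_ass _ _ p q.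
  move: (vB _ _ em) (wB _ _ em); move: (a + _) (b + _) => p q pB qB.
  have mid : (p <= t * p + (1 - t) * q <= q) || (q <= t * p + (1 - t) * q <= p).
    by have [pq|/ltW qp] := leP p q; apply/orP; [left|right];
      apply/andP; split; nra.
  move: pB qB; rewrite !ler_norml => /andP[p1 p2] /andP[q1 q2].
  by case/orP: mid => /andP[/mono h1 /mono h2]; apply/andP; split; lra.
have -> : y k.+1 m = t * v k.+1 m - (t - 1) * w k.+1 m by [].
rewrite hv // hw // /y.
have := H_p_tangent H_ass (xg N m) (tg K k).
set p := a + _; set q := b + _ => tang.
have hcv : H (xg N m) (tg K k) (t * p + (1 - t) * q) <=
    t * H (xg N m) (tg K k) p + (1 - t) * H (xg N m) (tg K k) q.
  have := tang (t * p + (1 - t) * q) p; have := tang (t * p + (1 - t) * q) q.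
  set D := H_p _ _ _ _ ; set Z := H _ _ (_ + _) => h1.
  move=> /(ler_wpM2l t0) h2.
  have t1' : 0 <= 1 - t by rewrite subr_ge0.
  by move: (ler_wpM2l t1' h1) h2; lra.
have := ler_wpM2l (ltW dt0) hcv; lra.
Qed.
End discrete_effective.

(** * Differentiability of the effective Hamiltonian *)

(** The derivative at x is squeezed out as the supremum over y of the lower bounds
    Q(x, y) - C |y - x| of the difference quotients Q. Symmetry of Q makes it
    Lipschitz. When a = b the punctured neighbourhoods are empty. *)
Lemma C1_on_three_point (R : realType) (a b C : R) (f : R -> R) : a <= b -> 0 < C ->
  (forall x y z, a <= x <= b -> a <= y <= b -> a <= z <= b -> y != x -> z != x ->
    (f z - f x) / (z - x) - (f y - f x) / (y - x) <= C * (`|y - x| + `|z - x|)) ->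
  C1_on a b f.
Proof.
move=> ab C0 hC.
pose slopes x := [set (f y - f x) / (y - x) - C * `|y - x| | y in [set y | a <= y <= b /\ y != x]].
pose f' x := sup (slopes x).
have f'E x y : a <= x <= b -> a <= y <= b -> y != x ->
    `|(f y - f x) / (y - x) - f' x| <= C * `|y - x|.
  move=> xab yab yx.
  have ub z : a <= z <= b -> z != x -> ubound (slopes x) ((f z - f x) / (z - x) + C * `|z - x|).
    move=> zab zx _ [t [tab tx] <-]; have := hC x z t xab zab tab zx tx; lra.
  have ne : slopes x !=set0 by exists ((f y - f x) / (y - x) - C * `|y - x|), y.
  have h1 : f' x <= (f y - f x) / (y - x) + C * `|y - x| by apply: ge_sup => //; exact: ub.
  have h2 : (f y - f x) / (y - x) - C * `|y - x| <= f' x.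
    apply: ub_le_sup; last by exists y.
    by exists ((f y - f x) / (y - x) + C * `|y - x|); exact: ub.
  by rewrite ler_norml; apply/andP; split; lra.
have f'lip x y : a <= x <= b -> a <= y <= b -> `|f' x - f' y| <= 2 * C * `|x - y|.
  move=> xab yab; have [->|xy] := eqVneq x y; first by rewrite !subrr normr0 mulr0.
  have yx : y != x by rewrite eq_sym.
  have := f'E x y xab yab yx; have := f'E y x yab xab xy.
  have -> : (f x - f y) / (x - y) = (f y - f x) / (y - x).
    by rewrite -[x - y]opprB invrN mulrN -mulNr opprB.
  rewrite (distrC y x) !ler_norml => /andP[? ?] /andP[? ?].
  by apply/andP; split; lra.
have near_of (x r : R) (P : R -> Prop) : 0 < r -> (forall y, `|x - y| < r -> P y) ->
    \forall y \near x, P y.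
  by move=> r0 hP; apply/nbhs_ballP; exists r => // y; exact: hP.
exists f'; split.
  apply/subspace_continuousP => x /=; rewrite in_itv /= => xab.
  apply/cvgrPdist_le => e e0; rewrite near_withinE.
  apply: (near_of x (e / (2 * C))) => [|y xy yab]; first by rewrite divr_gt0 ?mulr_gt0.
  rewrite /= in_itv /= in yab; apply: le_trans (f'lip x y xab yab) _.
  by rewrite mulrC -ler_pdivlMr ?mulr_gt0 // ltW.
move=> x; rewrite in_itv /= => xab.
apply/cvgrPdist_le => e e0; rewrite near_withinE /dnbhs near_withinE.
apply: (near_of x (e / C)) => [|y xy /= yx]; first by rewrite divr_gt0.
rewrite in_itv /= => yab; rewrite distrC.
apply: le_trans (f'E x y xab yab yx) _.
by rewrite mulrC -ler_pdivlMr // distrC ltW.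
Qed.

Section derivative_of_effective_hamiltonian.
Context {R : realType} (H : R -> R -> R -> R) (H_ass : hamiltonian_assumptions H).
Context (N K : nat) (N0 : (0 < N)%N) (NK : (N <= K)%N) (B : R) (B0 : 0 <= B)
  (cfl1 : B * (dt K / dx N) < 1).
Implicit Types (v w : nat -> int -> R) (c h : R).

Let K0 : (0 < K)%N := leq_trans N0 NK.
Let dx0 : 0 < dx N :> R := dx_gt0 N0.
Let dt0 : 0 < dt K :> R := dt_gt0 K0.

Definition periodic_solution c h v : Prop :=
  [/\ doubly_periodic N K v, cfl_bound H N K B c v & hj_equation H N K c h v].

Lemma increment_upwind c c' h h' v w :
  periodic_solution c h v -> periodic_solution c' h' w ->
  upwind_subsolution N K B (B * `|c' - c| + (h' - h)) (fun k m => w k m - v k m).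
Proof.
move=> [vP vB hv] [wP wB hw] k m em.
have [s [se _ sB]] := H_secant H_ass (xg N m) (tg K k)
  (c + slope N v k m) (c' + slope N w k m).
have {}sB := sB B (vB _ _ em) (wB _ _ em).
exists s => //; rewrite slopeB hv // hw //.
have sc : - (s * (c' - c)) <= B * `|c' - c|.
  by apply: le_trans (ler_norm _) _; rewrite normrN normrM ler_wpM2r.
move/eqP: se; rewrite subr_eq => /eqP ->.
have := ler_wpM2l (ltW dt0) sc; lra.
Qed.

(** One-sided; exchanging the two solutions gives the other inequality. *)
Lemma effective_lipschitz c c' h h' v w :
  periodic_solution c h v -> periodic_solution c' h' w -> h - h' <= B * `|c' - c|.
Proof.
move=> sv sw; have [[vP _ _] [wP _ _]] := (sv, sw).
have [d1 d2] := doubly_periodicB wP vP.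
have := maximum_principle N0 NK cfl1 d1 d2 (increment_upwind sv sw); lra.
Qed.

Let slope_gain : R := cone_deficit N K B (6 * K) * (2 * B) / (2 * dx N).

(** The oscillation bound applied to w - v, whose source is of order |c' - c|. *)
Lemma slope_increment c c' h h' v w k m :
  periodic_solution c h v -> periodic_solution c' h' w -> even_node k m ->
  `|slope N w k m - slope N v k m| <= slope_gain * `|c' - c|.
Proof.
move=> sv sw em; have [[vP _ _] [wP _ _]] := (sv, sw).
have [d1 d2] := doubly_periodicB wP vP.
have tr := increment_upwind sv sw.
have hh : B * `|c' - c| + (h' - h) <= 2 * B * `|c' - c|.
  by have := effective_lipschitz sw sv; rewrite distrC; lra.
have [nd1 nd2] := even_pred_succ em.
have /andP[D0 _] := cone_deficit_le N0 NK cfl1 B0 (leqnn (6 * K)).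
have osc p q : ~~ even_node k p -> ~~ even_node k q ->
    (w k p - v k p) - (w k q - v k q) <= cone_deficit N K B (6 * K) * (2 * B * `|c' - c|).
  move=> np nq; apply: le_trans (oscillation_le N0 NK cfl1 B0 d1 d2 tr np nq) _.
  exact: ler_wpM2l.
rewrite -slopeB /slope normrM normfV (gtr0_norm (_ : 0 < 2 * dx N)) ?mulr_gt0 //.
rewrite ler_pdivrMr ?mulr_gt0 //.
have -> : slope_gain * `|c' - c| * (2 * dx N) =
    cone_deficit N K B (6 * K) * (2 * B * `|c' - c|).
  by rewrite /slope_gain; field; rewrite gt_eqF.
rewrite ler_norml; apply/andP; split; last exact: osc.
by rewrite lerNl opprB; exact: osc.
Qed.

(** The difference quotients in c of the periodic solutions based at x satisfy
    linear upwind schemes whose transport coefficients are secant slopes of H near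
    the slopes of the solution at x, so they are close to each other. The maximum
    principle for the difference of two quotients then compares the corresponding
    sources, which are the difference quotients of the effective Hamiltonian. *)
Lemma effective_three_point : exists2 C, 0 < C & forall x y z hx hy hz vx vy vz,
  periodic_solution x hx vx -> periodic_solution y hy vy -> periodic_solution z hz vz ->
  y != x -> z != x ->
  (hz - hx) / (z - x) - (hy - hx) / (y - x) <= C * (`|y - x| + `|z - x|).
Proof.
have [M M0 hM] := H_p_coercive H_ass B.
have [Lp Lp0 hLp] := strip_lipschitz M (H_p_torus_periodic H_ass) (on_R3_H_p_C1 H_ass).
have G0 : 0 <= slope_gain.
  have /andP[D0 _] := cone_deficit_le N0 NK cfl1 B0 (leqnn (6 * K)).
  by rewrite /slope_gain divr_ge0 ?mulr_ge0 // ltW.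
pose G1 := 1 + slope_gain; have G10 : 0 < G1 by rewrite ltr_pwDl.
exists (Lp * G1 * G1); first by rewrite !mulr_gt0.
move=> x y z hx hy hz vx vy vz sx sy sz yx zx.
have sl u hu vu : periodic_solution u hu vu -> u != x -> forall k m, even_node k m ->
    exists s, [/\ H (xg N m) (tg K k) (u + slope N vu k m)
         - H (xg N m) (tg K k) (x + slope N vx k m)
         = s * ((u + slope N vu k m) - (x + slope N vx k m)),
       `|s| <= B & `|s - H_p H (xg N m) (tg K k) (x + slope N vx k m)| <= Lp * G1 * `|u - x|].
  move=> su ux k m em; have [_ uB _] := su; have [_ xB _] := sx.
  have [s [se sd sB]] := H_secant H_ass (xg N m) (tg K k)
    (x + slope N vx k m) (u + slope N vu k m).
  exists s; split => //; first by apply: sB; [exact: xB | exact: uB].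
  apply: le_trans sd _.
  have := hLp (xg N m) (tg K k) (u + slope N vu k m) (xg N m) (tg K k) (x + slope N vx k m)
    (hM _ _ _ (uB _ _ em)) (hM _ _ _ (xB _ _ em)).
  rewrite !subrr normr0 !add0r => h; apply: le_trans h _.
  rewrite -mulrA ler_wpM2l ?(ltW Lp0) //.
  have -> : u + slope N vu k m - (x + slope N vx k m) =
      (u - x) + (slope N vu k m - slope N vx k m) by ring.
  apply: le_trans (ler_normD _ _) _; rewrite /G1 mulrDl mul1r lerD2l.
  exact: (slope_increment sx su em).
have [[xP _ ex] [yP _ ey] [zP _ ez]] := And3 sx sy sz.
(* w u vu is the difference quotient in c, based at x. *)
pose w u (vu : nat -> int -> R) k m := (u - x)^-1 * (vu k m - vx k m).
have [d1 d2] : doubly_periodic N K (fun k m => w y vy k m - w z vz k m).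
  by apply: doubly_periodicB; apply: doubly_periodicZ; exact: doubly_periodicB.
rewrite -subr_ge0.
apply: (maximum_principle N0 NK cfl1 d1 d2) => k m em.
have [s [se sB sd]] := sl y hy vy sy yx k m em.
have [s' [se' _ sd']] := sl z hz vz sz zx k m em.
exists s => //; rewrite slopeB !slopeZ !slopeB.
have yx0 : y - x != 0 by rewrite subr_eq0.
have zx0 : z - x != 0 by rewrite subr_eq0.
have wE u hu vu (s0 : R) : u - x != 0 -> hj_equation H N K u hu vu ->
    H (xg N m) (tg K k) (u + slope N vu k m) - H (xg N m) (tg K k) (x + slope N vx k m)
         = s0 * ((u + slope N vu k m) - (x + slope N vx k m)) ->
    w u vu k.+1 m = (w u vu k (m - 1) + w u vu k (m + 1)) / 2
      - dt K * (s0 * (1 + (u - x)^-1 * (slope N vu k m - slope N vx k m)))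
      + dt K * ((hu - hx) / (u - x)).
  move=> ux0 eu e0; rewrite /w eu // ex //.
  have -> : H (xg N m) (tg K k) (u + slope N vu k m) =
    H (xg N m) (tg K k) (x + slope N vx k m) + s0 * ((u + slope N vu k m) - (x + slope N vx k m)).
    by rewrite -e0; ring.
  by field.
rewrite (wE y hy vy s) // (wE z hz vz s') //.
set D' := (z - x)^-1 * (slope N vz k m - slope N vx k m).
set D := (y - x)^-1 * (slope N vy k m - slope N vx k m).
have D'le : `|1 + D'| <= G1.
  apply: le_trans (ler_normD _ _) _; rewrite normr1 lerD2l /D' normrM normfV.
  rewrite mulrC ler_pdivrMr ?normr_gt0 //; exact: (slope_increment sx sz em).
have key : - ((s - s') * (1 + D')) <= Lp * G1 * G1 * (`|y - x| + `|z - x|).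
  apply: le_trans (ler_norm _) _; rewrite normrN normrM.
  have -> : Lp * G1 * G1 * (`|y - x| + `|z - x|) = (Lp * G1 * `|y - x| + Lp * G1 * `|z - x|) * G1 by ring.
  apply: ler_pM => //.
  have -> : s - s' = (s - H_p H (xg N m) (tg K k) (x + slope N vx k m))
      - (s' - H_p H (xg N m) (tg K k) (x + slope N vx k m)) by ring.
  by apply: le_trans (ler_normB _ _) _; exact: lerD.
have := ler_wpM2l (ltW dt0) key; lra.
Qed.
End derivative_of_effective_hamiltonian.

(** * Long-time average *)

Section long_time.
Context {R : realType} (H : R -> R -> R -> R) (H_ass : hamiltonian_assumptions H).
Context (N K : nat) (N0 : (0 < N)%N) (NK : (N <= K)%N) (B : R)
  (cfl1 : B * (dt K / dx N) < 1).
Implicit Types (v w : nat -> int -> R) (c h : R).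

Let K0 : (0 < K)%N := leq_trans N0 NK.
Let dx0 : 0 < dx N :> R := dx_gt0 N0.
Let dt0 : 0 < dt K :> R := dt_gt0 K0.

Lemma doubly_periodic_bounded v : doubly_periodic N K v ->
  exists C, forall k m, ~~ even_node k m -> `|v k m| <= C.
Proof.
move=> [vx vt].
have [||k [m [_ _ vmax]]] := @grid_argmax R N K (fun k m => `|v k m|) N0 K0.
- by move=> k m o; rewrite vx.
- by move=> k m o; rewrite vt.
by exists (`|v k.+1 m|).
Qed.

(** The function V - h t solves the equation with right-hand side 0, so its distance
    to v does not increase in time. *)
Lemma long_time_bounded c h v V : space_periodic N v -> cfl_bound H N K B c v ->
  hj_equation H N K c 0 v -> periodic_solution H N K B c h V ->
  exists C, forall k m, ~~ even_node k m -> `|v k m + h * tg K k| <= C.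
Proof.
move=> vx vB hv [[Vx Vt] VB hV].
pose w k m := v k m - V k m + h * tg K k.
have [C C0 w0] : exists2 C, 0 <= C & forall m, ~~ even_node 0 m -> `|w 0%N m| <= C.
  apply: (@level_bounded R N (fun m => ~~ even_node 0 m) (w 0%N) N0) => m.
    by rewrite even_node_period.
  by move=> o; rewrite /w vx // Vx.
have wC k : forall m, ~~ even_node k m -> `|w k m| <= C.
  elim: k => [//|k IH] m; rewrite even_node_S => em.
  have [s [se _ /(_ B) sB]] := H_secant H_ass (xg N m) (tg K k)
    (c + slope N V k m) (c + slope N v k m).
  have {}sB := sB (VB _ _ em) (vB _ _ em).
  have e : w k.+1 m = (w k (m - 1) + w k (m + 1)) / 2
      - dt K * (s * ((w k (m + 1) - w k (m - 1)) / (2 * dx N))).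
    rewrite /w hv // hV // tgS; move/eqP: se; rewrite subr_eq => /eqP ->.
    by rewrite /slope; field; rewrite gt_eqF.
  have [/IH n1 /IH n2] := even_pred_succ em.
  move: n1 n2; rewrite !ler_norml => /andP[a1 a2] /andP[b1 b2].
  apply/andP; split; last by rewrite e; exact: (upwind_le N0 NK cfl1).
  have := @upwind_le R N K N0 NK B cfl1 s (- w k (m - 1)) (- w k (m + 1)) C sB.
  have -> : - w k (m + 1) - - w k (m - 1) = - (w k (m + 1) - w k (m - 1)) by ring.
  by rewrite e mulNr mulrN; lra.
have [D VD] := doubly_periodic_bounded (conj Vx Vt).
exists (C + D) => k m o.
have -> : v k m + h * tg K k = w k m + V k m by rewrite /w; ring.
by apply: le_trans (ler_normD _ _) _; apply: lerD; [exact: wC | exact: VD].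
Qed.

Lemma long_time_average c h v V : space_periodic N v -> cfl_bound H N K B c v ->
  hj_equation H N K c 0 v -> periodic_solution H N K B c h V ->
  forall n : int, v l.+1 n / tg K l.+1
    @[l --> within [set l : nat | ~~ even_node l.+1 n] \oo] --> - h.
Proof.
move=> vx vB hv sV n; have [C hC] := long_time_bounded vx vB hv sV.
apply/cvgrPdist_le => e e0; rewrite near_withinE.
exists (Num.truncn (C / e / dt K)).+1 => // l /= Cl o.
have t0 : 0 < tg K l.+1 :> R by rewrite mulr_gt0 ?ltr0n.
have -> : - h - v l.+1 n / tg K l.+1 = - (v l.+1 n + h * tg K l.+1) / tg K l.+1.
  by field; rewrite gt_eqF.
rewrite normrM normrN normfV (gtr0_norm t0) ler_pdivrMr //.
apply: le_trans (hC _ _ o) _.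
rewrite mulrC -ler_pdivrMr // /tg -ler_pdivrMr //.
apply: ltW; apply: lt_le_trans (truncnS_gt _) _.
by rewrite ler_nat; apply: leq_trans Cl _.
Qed.
End long_time.

(** * From Lax-Friedrichs to Hamilton-Jacobi solutions *)

Section mcshane.
Context {R : realType} (I : Type) (A : set I) (X S : I -> R) (r : R).
Hypothesis A0 : A !=set0.
Hypothesis S_lip : forall i j, A i -> A j -> `|S i - S j| <= r * `|X i - X j|.
Hypothesis r0 : 0 <= r.

(** The largest of the downward cones of slope r with apex on the given data: an
    r-Lipschitz extension, periodic as soon as the data are. *)
Definition mcshane (x : R) : R := sup [set S i - r * `|x - X i| | i in A].

Lemma mcshane_has_sup x : has_sup [set S i - r * `|x - X i| | i in A].
Proof.
have [j Aj] := A0; split; first by exists (S j - r * `|x - X j|), j.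
exists (S j + r * `|x - X j|) => _ [i Ai <-].
have := S_lip Ai Aj; have := ler_norm (S i - S j).
have : r * `|X i - X j| <= r * (`|x - X i| + `|x - X j|).
  by rewrite ler_wpM2l // (distrC x); have := ler_distD x (X i) (X j).
by rewrite mulrDr; lra.
Qed.

Lemma mcshane_eq i : A i -> mcshane (X i) = S i.
Proof.
move=> Ai; apply: le_anti; apply/andP; split.
  apply: ge_sup; first by have [] := mcshane_has_sup (X i).
  move=> _ [j Aj <-]; have := S_lip Aj Ai; rewrite distrC (distrC (X j)).
  by have := ler_norm (S j - S i); rewrite distrC; lra.
apply: ub_le_sup; first by have [] := mcshane_has_sup (X i).
by exists i => //; rewrite subrr normr0 mulr0 subr0.
Qed.

Lemma mcshane_lipschitz x y : `|mcshane x - mcshane y| <= r * `|x - y|.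
Proof.
have le (a b : R) : mcshane a <= mcshane b + r * `|a - b|.
  apply: ge_sup; first by have [] := mcshane_has_sup a.
  move=> _ [i Ai <-].
  have h : S i - r * `|b - X i| <= mcshane b.
    by apply: ub_le_sup; [have [] := mcshane_has_sup b | exists i].
  have : r * `|b - X i| <= r * (`|a - b| + `|a - X i|).
    by rewrite ler_wpM2l // (distrC a b); exact: ler_distD.
  by rewrite mulrDr; lra.
by rewrite ler_norml; apply/andP; split;
  have := le x y; have := le y x; rewrite (distrC y x); lra.
Qed.
End mcshane.

Section integrate_slopes.
Context {R : realType} (N : nat) (N0 : (0 < N)%N) (u : int -> R).
Hypothesis u_periodic : forall m, even_node 0 m -> u (m + (2 * N)%N%:Z) = u m.
Hypothesis u_mean : \sum_(i < N) u (2 * i%:Z) = 0.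

Let dx0 : 0 < dx N :> R := dx_gt0 N0.

(** Reducing the summation range modulo N makes periodicity immediate; the sum over a
    full period being 0, the wrap-around is consistent with the slopes. *)
Definition primitive (m : int) : R :=
  2 * dx N * \sum_(i < `|modz (divz (m + 1) 2) N%:Z|%N) u (2 * i%:Z).

Lemma primitive_periodic m : primitive (m + (2 * N)%N%:Z) = primitive m.
Proof.
rewrite /primitive; have -> : divz (m + (2 * N)%N%:Z + 1) 2 = divz (m + 1) 2 + N%:Z by lia.
by have -> : modz (divz (m + 1) 2 + N%:Z) N%:Z = modz (divz (m + 1) 2) N%:Z by rewrite modzDr.
Qed.

Lemma primitive_slope m : even_node 0 m ->
  primitive (m + 1) - primitive (m - 1) = 2 * dx N * u m.
Proof.
move=> em; rewrite /primitive subrK.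
pose j := divz m 2; have mE : m = 2 * j by move: em; rewrite /even_node /j; lia.
have -> : divz (m + 1 + 1) 2 = j + 1 by lia.
rewrite -/j -mulrBr; congr (_ * _).
have uE (i : int) : u (2 * modz i N%:Z) = u (2 * i).
  rewrite [in RHS](divz_eq i N%:Z).
  have -> : 2 * (divz i N%:Z * N%:Z + modz i N%:Z) =
    2 * modz i N%:Z + (2 * N)%N%:Z * divz i N%:Z by rewrite PoszM; ring.
  rewrite (@int_periodic _ (even_node 0) u) //; last by rewrite /even_node; lia.
  by move=> n; exact: even_node_period.
rewrite mE -(uE j).
have h : 0 <= modz j N%:Z < N%:Z by lia.
have : modz (j + 1) N%:Z = if modz j N%:Z + 1 == N%:Z then 0 else modz j N%:Z + 1.
  have e : modz (j + 1) N%:Z = modz (modz j N%:Z + 1) N%:Z by rewrite modzDml.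
  rewrite e; case: eqP => [->|ne]; first by rewrite modzz.
  by rewrite modz_small //; lia.
case: (modz j N%:Z) h => // p hp -> {uE}.
case: eqP => [pN|_].
  rewrite big_ord0 sub0r; have pN' : p.+1 = N by lia.
  move: u_mean; rewrite -pN' big_ord_recr /= => /eqP.
  by rewrite addrC addr_eq0 => /eqP ->.
have -> : absz (p%:Z + 1) = p.+1 by lia.
by rewrite big_ord_recr /= addrAC subrr add0r.
Qed.

Lemma primitive_lipschitz (r : R) m n : (forall i, even_node 0 i -> `|u i| <= r) ->
  ~~ even_node 0 m -> ~~ even_node 0 n ->
  `|primitive m - primitive n| <= r * `|xg N m - xg N n|.
Proof.
move=> ur; wlog mn : m n / n <= m => [hw om on|om on].
  have [nm|/ltW mn] := leP n m; first exact: hw.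
  by rewrite distrC (distrC (xg N m)); exact: hw.
have step (k : nat) : `|primitive (n + 2 * k%:Z) - primitive n| <= r * (k%:R * (2 * dx N)).
  elim: k => [|k IH]; first by rewrite mulr0 addr0 subrr normr0 mul0r mulr0.
  pose p := n + 2 * k%:Z + 1.
  have ep : even_node 0 p by move: on; rewrite /p /even_node; lia.
  have -> : n + 2 * k.+1%:Z = p + 1 by rewrite /p; lia.
  have := primitive_slope ep; rewrite {2}/p addrK => e.
  have -> : primitive (p + 1) - primitive n = 2 * dx N * u p + (primitive (n + 2 * k%:Z) - primitive n).
    by rewrite -e; ring.
  have -> : r * (k.+1%:R * (2 * dx N)) = r * (2 * dx N) + r * (k%:R * (2 * dx N)).
    by rewrite -addn1 natrD; ring.
  apply: le_trans (ler_normD _ _) _; apply: lerD => //.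
  have d0 : 0 < 2 * dx N :> R by rewrite mulr_gt0.
  by rewrite normrM gtr0_norm // [leLHS]mulrC ler_wpM2r ?ur // ltW.
pose k := `|divz (m - n) 2|%N.
have mE : m = n + 2 * k%:Z by move: om on; rewrite /k /even_node; lia.
have xE : xg N m - xg N n = k%:R * (2 * dx N) :> R.
  by rewrite mE xgD intrM -[k%:Z%:~R]/(k%:R) -[2%:~R]/(2%:R : R); ring.
have := step k; rewrite -mE xE => h; apply: le_trans h _.
by rewrite ger0_norm // mulr_ge0 // ltW // mulr_gt0.
Qed.
End integrate_slopes.

Section level_sums.
Context {R : realType}.
Implicit Types (N k : nat) (G : int -> R).

Lemma sum_shift N G : G (2 * N)%N%:Z = G 0 ->
  \sum_(0 <= m < 2 * N) G (m%:Z + 1) = \sum_(0 <= m < 2 * N) G m%:Z.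
Proof.
move=> GP; apply/eqP; rewrite -subr_eq0 -sumrB.
have -> : \sum_(0 <= m < 2 * N) (G (m%:Z + 1) - G m%:Z) = G (2 * N)%N%:Z - G 0.
  elim: (2 * N)%N => [|n IH]; first by rewrite big_nil subrr.
  rewrite big_nat_recr //= IH; have -> : n%:Z + 1 = n.+1%:Z by lia.
  by ring.
by rewrite GP subrr.
Qed.

Lemma sum_even_nodes N k (a : R) :
  \sum_(0 <= m < 2 * N | even_node k m%:Z) a = N%:R * a.
Proof.
rewrite big_mkcond /=; elim: N => [|N IH]; first by rewrite muln0 big_nil mul0r.
have -> : (2 * N.+1 = (2 * N).+2)%N by lia.
rewrite !big_nat_recr //= IH.
have -> : even_node k (2 * N).+1%:Z = ~~ even_node k (2 * N)%N%:Z.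
  by rewrite /even_node; lia.
by rewrite -natr1; case: (even_node k _) => /=; ring.
Qed.

Lemma sum_neighbors N k (g : int -> R) :
  (forall m, ~~ even_node k m -> g (m + (2 * N)%N%:Z) = g m) ->
  \sum_(0 <= m < 2 * N | even_node k m%:Z) (g (m%:Z - 1) + g (m%:Z + 1)) / 2
  = \sum_(0 <= m < 2 * N | ~~ even_node k m%:Z) g m%:Z.
Proof.
move=> gP; pose G m := if even_node k m then 0 else g m.
have GP m : G (m + (2 * N)%N%:Z) = G m.
  by rewrite /G even_node_period; case: ifPn => // /gP.
have e1 : \sum_(0 <= m < 2 * N) G (m%:Z + 1) = \sum_(0 <= m < 2 * N) G m%:Z.
  by apply: sum_shift; rewrite -[in LHS](add0r (2 * N)%N%:Z) GP.
have e2 : \sum_(0 <= m < 2 * N) G (m%:Z - 1) = \sum_(0 <= m < 2 * N) G m%:Z.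
  rewrite -(@sum_shift _ (fun m => G (m - 1))); last by rewrite addrC GP.
  by apply: eq_bigr => m _; rewrite addrK.
have -> : \sum_(0 <= m < 2 * N | ~~ even_node k m%:Z) g m%:Z = \sum_(0 <= m < 2 * N) G m%:Z.
  by rewrite big_mkcond; apply: eq_bigr => m _; rewrite /G if_neg.
have -> : \sum_(0 <= m < 2 * N | even_node k m%:Z) (g (m%:Z - 1) + g (m%:Z + 1)) / 2 =
    \sum_(0 <= m < 2 * N) (G (m%:Z - 1) + G (m%:Z + 1)) / 2.
  rewrite big_mkcond; apply: eq_bigr => m _; rewrite /G.
  have -> : even_node k (m%:Z - 1) = ~~ even_node k m%:Z by rewrite /even_node; lia.
  have -> : even_node k (m%:Z + 1) = ~~ even_node k m%:Z by rewrite /even_node; lia.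
  by case: ifP => //= _; rewrite addr0 mul0r.
by rewrite -mulr_suml big_split /= e1 e2; field.
Qed.
End level_sums.

Section from_lax_friedrichs.
Context {R : realType} (H : R -> R -> R -> R).
Context (N K : nat) (N0 : (0 < N)%N) (K0 : (0 < K)%N) (c : R).

Let dx0 : 0 < dx N :> R := dx_gt0 N0.
Let dt0 : 0 < dt K :> R := dt_gt0 K0.

(** In the sum of the scheme over one time level the averages of neighbours
    reproduce the previous sum, so a period changes the total by N times
    the mean of h - H. *)
Lemma averaged_balance h (v : nat -> int -> R) : space_periodic N v ->
  hj_equation H N K c h v ->
  \sum_(0 <= m < 2 * N | ~~ even_node (2 * K) m%:Z) v (2 * K)%N m%:Z
  - \sum_(0 <= m < 2 * N | ~~ even_node 0 m%:Z) v 0%N m%:Z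
  = N%:R * (h - averaged_hamiltonian H N K c (slope N v)).
Proof.
move=> vP hv.
pose T k := \sum_(0 <= m < 2 * N | ~~ even_node k m%:Z) v k m%:Z.
pose L k := \sum_(0 <= m < 2 * N | even_node k m%:Z)
    H (xg N m%:Z) (tg K k) (c + slope N v k m%:Z).
have TS k : T k.+1 = T k - dt K * (L k - N%:R * h).
  rewrite /T (eq_bigl (fun m : nat => even_node k m%:Z)); last first.
    by move=> m; rewrite even_node_S.
  rewrite (eq_bigr (fun m : nat => (v k (m%:Z - 1) + v k (m%:Z + 1)) / 2
    - dt K * (H (xg N m%:Z) (tg K k) (c + slope N v k m%:Z) - h))); last first.
    by move=> m em; rewrite hv.
  rewrite sumrB sum_neighbors; last exact: vP.
  by rewrite -mulr_sumr sumrB sum_even_nodes.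
have Tn n : T n - T 0%N = dt K * (n%:R * N%:R * h - \sum_(0 <= k < n) L k).
  elim: n => [|n IH]; first by rewrite big_nil !mul0r !subrr mulr0.
  rewrite TS big_nat_recr //= -[in RHS]addn1 natrD.
  by move: IH => /eqP; rewrite subr_eq => /eqP ->; ring.
rewrite -/(T (2 * K)%N) -/(T 0%N) Tn.
have -> : averaged_hamiltonian H N K c (slope N v) =
    2 * dx N * dt K * \sum_(0 <= k < 2 * K) L k.
  rewrite /averaged_hamiltonian mulr_sumr; apply: eq_bigr => k _.
  by rewrite mulr_sumr; apply: eq_bigr => m _; rewrite mulrC.
have e1 := dxM N0 : _ = 1 :> R; have e2 := dtM K0 : _ = 1 :> R.
rewrite natrM in e1; set S := \sum_(_ <= _ < _) _.
transitivity ((2 * K)%:R * dt K * (N%:R * h) - 2 * N%:R * dx N * (dt K * S)); last first.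
  by rewrite e2; ring.
by rewrite e1; ring.
Qed.

Fixpoint integrate (h : R) (v0 : int -> R) (u : nat -> int -> R) k : int -> R :=
  if k is k'.+1 then fun m =>
    (integrate h v0 u k' (m - 1) + integrate h v0 u k' (m + 1)) / 2
    - dt K * (H (xg N m) (tg K k') (c + u k' m) - h)
  else v0.

(** The Lax-Friedrichs scheme is the difference in x of the Hamilton-Jacobi one. *)
Lemma integrate_slope h v0 u :
  (forall m, even_node 0 m -> v0 (m + 1) - v0 (m - 1) = 2 * dx N * u 0%N m) ->
  (forall k m, even_node k m ->
    (u k.+1 (m + 1) - (u k m + u k (m + 2)) / 2) / dt K
    + (H (xg N (m + 2)) (tg K k) (c + u k (m + 2))
       - H (xg N m) (tg K k) (c + u k m)) / (2 * dx N) = 0) ->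
  forall k m, even_node k m -> slope N (integrate h v0 u) k m = u k m.
Proof.
move=> e0 hu; have dxn : dx N != 0 :> R by rewrite gt_eqF.
have dtn : dt K != 0 :> R by rewrite gt_eqF.
elim=> [|k IH] m em; first by rewrite /slope /= e0 // mulrC mulKf // mulf_neq0.
have em1 : even_node k (m - 1) by move: em; rewrite /even_node; lia.
have em2 : even_node k (m + 1) by move: em; rewrite /even_node; lia.
have := hu k (m - 1) em1; have := IH _ em1; have := IH _ em2.
rewrite /slope /= !subrK -(addrA m 1 (-1)) subrr addr0 (_ : m - 1 + 2 = m + 1); last by ring.
set v := integrate h v0 u k; set X := H _ _ _; set Y := H _ _ _.
move=> <- <- e.
have -> : u k.+1 m = ((v m - v (m - 1 - 1)) / (2 * dx N) + (v (m + 1 + 1) - v m) / (2 * dx N)) / 2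
    - dt K * ((X - Y) / (2 * dx N)).
  apply: (mulIf (invr_neq0 dtn)); apply/eqP; rewrite -subr_eq0 -[X in _ == X]e.
  by apply/eqP; field; rewrite dtn dxn.
by field.
Qed.
End from_lax_friedrichs.

(** * Fixed points of the time-one maps *)

Section time_periodicity.
Context {R : realType} (H : R -> R -> R -> R) (H_per : torus_periodic H).
Context (N K : nat) (N0 : (0 < N)%N) (K0 : (0 < K)%N).
Implicit Types (v : nat -> int -> R) (c h : R).

Lemma time_periodic_of_period c h v : hj_equation H N K c h v ->
  (forall m, ~~ even_node 0 m -> v (2 * K)%N m = v 0%N m) -> time_periodic K v.
Proof.
move=> hv v0; elim=> [|k IH] m; first by rewrite add0n; exact: v0.
rewrite addSn even_node_S => em.
have em' : even_node (k + 2 * K)%N m by rewrite even_node_time_period.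
have [nd1 nd2] := even_pred_succ em.
rewrite hv // hv // /slope !IH // tg_period //.
by have [_ ->] := H_per.
Qed.

Lemma v_interp_node v m : ~~ even_node 0 m -> v_interp N K v (xg N m) 1 = v (2 * K)%N m.
Proof.
move=> om; rewrite /v_interp.
have -> : time_step K (1 : R) = (2 * K)%N by rewrite -(dtM K0) -/(tg _ _) time_step_grid.
rewrite center_node //; last by rewrite -(even_node_time_period K) in om.
by rewrite addrK subrr mulr0 addr0.
Qed.

Lemma u_interp_step (u : nat -> int -> R) x : u_interp N K u x 1 = step N (u (2 * K)%N) x.
Proof.
rewrite /u_interp.
have -> : time_step K (1 : R) = (2 * K)%N by rewrite -(dtM K0) -/(tg _ _) time_step_grid.
by rewrite center_time_period.
Qed.

Lemma hj_initial_odd c h (r : R) (v0 : R -> R) v m :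
  hj_solution H N K c h r v0 v -> ~~ even_node 0 m -> v 0%N m = v0 (xg N m).
Proof.
move=> hv om; have := hj_initial hv (_ : even_node 0 (m - 1)); rewrite subrK.
by apply; move: om; rewrite /even_node; lia.
Qed.

Lemma fixed_point_time_periodic c h (r : R) (v0 : R -> R) v :
  hj_solution H N K c h r v0 v -> (forall x, v_interp N K v x 1 = v0 x) -> time_periodic K v.
Proof.
move=> hv fx; apply: (@time_periodic_of_period c h).
  by apply/hj_equationP => //; exact: hj_scheme hv.
by move=> m om; rewrite (hj_initial_odd hv om) -fx v_interp_node.
Qed.

(** Otherwise the integral of 0 over the interval would be b - a. *)
Lemma ae_itv_false (a b : R) : a < b ->
  ~ {ae (@lebesgue_measure R), forall x, ~ (a <= x < b)}.
Proof.
move=> ab aeF; have m0 : measurable_fun [set: R] (fun=> 0 : R) by exact: measurable_cst.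
have e1 := @Rintegral_ae_const R _ a b 1 (ltW ab) m0
  (ae_sub (fun x (hx : ~ (a <= x < b)) (hx' : a <= x < b) => match hx hx' with end) aeF).
have e0 := @Rintegral_ae_const R _ a b 0 (ltW ab) m0 (aeW _ (fun x _ => erefl)).
by move: e1; rewrite e0 mulr0 mulr1 => /esym/eqP; rewrite subr_eq0 gt_eqF.
Qed.

(** The fixed point is almost everywhere a step function, so its cell averages, its
    mean and its essential bound can be read off the grid values. *)
Lemma periodic_lf_initial c (r : R) (u : nat -> int -> R) :
  periodic_lf_solution H N K r c u ->
  [/\ forall m, even_node 0 m -> u (2 * K)%N m = u 0%N m,
      \sum_(i < N) u 0%N (2 * i%:Z) = 0 &
      forall m, even_node 0 m -> `|u 0%N m| <= r].
Proof.
case=> u0 [[mu0 u0P u0r u0m] hu fx].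
have dx0 : 0 < dx N :> R := dx_gt0 N0.
have st : {ae (@lebesgue_measure R), forall x, step N (u (2 * K)%N) x = u0 x}.
  by apply: ae_sub fx => x; rewrite u_interp_step.
have e0 m : even_node 0 m -> u (2 * K)%N m = u 0%N m.
  move=> em; rewrite (lf_initial hu em) (cell_integral N0 mu0 st em) mulKf //.
  by rewrite mulf_neq0 // gt_eqF.
have uP m : even_node 0 m -> u (2 * K)%N (m + (2 * N)%N%:Z) = u (2 * K)%N m.
  by move=> em; apply: (lf_periodic hu); rewrite -(even_node_time_period K) in em.
split => // [|m em].
  have /eqP := unit_integral N0 mu0 uP st; rewrite u0m eq_sym mulf_eq0.
  rewrite mulf_eq0 pnatr_eq0 /= gt_eqF //= => /eqP s0.
  by rewrite -[RHS]s0; apply: eq_bigr => i _; rewrite e0 //; rewrite /even_node; lia.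
rewrite leNgt; apply/negP => rm.
have aer : {ae (@lebesgue_measure R), forall x, `|u0 x| <= r}.
  move: u0r; rewrite /Linf_norm unlock.
  have -> : (0 < (@lebesgue_measure R) [set: R])%E.
    by rewrite -set_itvNyy lebesgue_measure_itv /= lt0y.
  by move/ess_supP; apply: ae_sub => x /=; rewrite lee_fin.
have ab : xg N (m - 1) < xg N (m + 1) :> R by rewrite xgB1 xgD1; lra.
apply: (ae_itv_false ab).
have := @filterI _ _ (ae_filter_ringOfSetsType (@lebesgue_measure R)) _ _ st aer.
apply: ae_sub => x [e ur] xm.
by move: ur; rewrite -e (step_cell _ N0 em xm) e0 // leNgt rm.
Qed.
End time_periodicity.

(** * Effective Hamiltonian on one mesh *)

Section one_mesh.
Context {R : realType} (H : R -> R -> R -> R) (H_ass : hamiltonian_assumptions H).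
Context (N K : nat) (N0 : (0 < N)%N) (NK : (N <= K)%N) (B r c : R) (r0 : 0 <= r)
  (cfl1 : B * (dt K / dx N) < 1).
Hypothesis lf_cfl : forall u0, Linf0 r u0 -> forall u, lf_solution H N K c u0 u ->
  forall k m, even_node k m -> `|H_p H (xg N m) (tg K k) (c + u k m)| <= B.

Let K0 : (0 < K)%N := leq_trans N0 NK.
Let dx0 : 0 < dx N :> R := dx_gt0 N0.
Let dt0 : 0 < dt K :> R := dt_gt0 K0.

Lemma hj_solution_cfl h v0 v : hj_solution H N K c h r v0 v -> cfl_bound H N K B c v.
Proof.
by move=> hv; have [u0 u0r hu] := hj_slope_lf_solution N0 K0 r0 hv; exact: lf_cfl hu.
Qed.

Lemma hj_solution_periodic h v0 v : hj_solution H N K c h r v0 v -> time_periodic K v ->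
  periodic_solution H N K B c h v.
Proof.
move=> hv vt; split; first by split => //; exact: hj_periodic hv.
  exact: hj_solution_cfl hv.
by apply/hj_equationP => //; exact: hj_scheme hv.
Qed.

Lemma fixed_point_periodic_solution h : discrete_effective_hamiltonian H N K r c h ->
  exists v0 v, hj_solution H N K c h r v0 v /\ periodic_solution H N K B c h v.
Proof.
case=> v0 [v [hv fx]]; exists v0, v; split => //; apply: (hj_solution_periodic hv).
apply: (fixed_point_time_periodic _ _ _ hv fx) => //; exact: ham_torus_periodic.
Qed.

Lemma discrete_effective_unique h : discrete_effective_hamiltonian H N K r c h ->
  unique (has_periodic_hj_solution H N K r c) h.
Proof.
move=> /fixed_point_periodic_solution[v0 [v [hv sv]]].
have [[vx vt] vB ev] := sv.
split; first by exists v0, v.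
move=> h' [w0 [w [hw wt]]]; have [[wx _] wB ew] := hj_solution_periodic hw wt.
exact: (hj_unique H_ass N0 NK cfl1 (conj vx vt) (conj wx wt) vB wB ev ew).
Qed.

(** Integrate u to a solution v with h' the average of H. After one period v changes
    by a constant, since its slopes are periodic, and the constant vanishes by the
    choice of h'. Hence h' is an effective value, and that value is unique. *)
Lemma periodic_lf_average h u : discrete_effective_hamiltonian H N K r c h ->
  periodic_lf_solution H N K r c u -> h = averaged_hamiltonian H N K c u.
Proof.
move=> heff hu; have [_ huniq] := discrete_effective_unique heff.
have [u2K umean ur] := periodic_lf_initial N0 K0 hu.
have [u0 [_ lfu _]] := hu.
have uP k m : even_node k m -> u k (m + (2 * N)%N%:Z) = u k m.
  exact: lf_periodic lfu k m.
set h' := averaged_hamiltonian H N K c u.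
pose S := primitive N (u 0%N).
have Sslope m : even_node 0 m -> S (m + 1) - S (m - 1) = 2 * dx N * u 0%N m.
  exact: (primitive_slope N0 (uP 0%N) umean).
have Slip m n : ~~ even_node 0 m -> ~~ even_node 0 n ->
    `|S m - S n| <= r * `|xg N m - xg N n|.
  exact: (primitive_lipschitz N0 (uP 0%N) umean ur).
pose v := integrate H N K c h' S u.
have vslope k m : even_node k m -> slope N v k m = u k m.
  exact: (integrate_slope N0 K0 h' Sslope (lf_scheme lfu)).
have vE : hj_equation H N K c h' v by move=> k m em; rewrite [LHS]/= vslope.
have vP : space_periodic N v.
  elim=> [|k IH] m; first by move=> _; exact: primitive_periodic.
  rewrite even_node_S => em; have em' : even_node k (m + (2 * N)%N%:Z).
    by rewrite even_node_period.
  have [nd1 nd2] := even_pred_succ em.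
  rewrite !vE // !vslope // uP // addrAC IH // [m + _ + 1]addrAC IH //.
  by rewrite xg_period //; have [-> _] := ham_torus_periodic H_ass.
have avE : averaged_hamiltonian H N K c (slope N v) = h'.
  by apply: eq_bigr => k _; apply: eq_bigr => m em; rewrite vslope.
have v2K m : ~~ even_node 0 m -> v (2 * K)%N m = v 0%N m.
  (* Equal slopes at times 0 and 1 make the increment d constant in space. *)
  pose d m := v (2 * K)%N m - v 0%N m.
  have dstep n : ~~ even_node 0 n -> d (n + 2%N%:Z) = d n.
    move=> on; have en : even_node 0 (n + 1) by move: on; rewrite /even_node; clear; lia.
    have en' : even_node (2 * K) (n + 1) by rewrite -[(2 * K)%N]add0n even_node_time_period.
    have := vslope _ _ en'; rewrite u2K // -(vslope _ _ en) /slope addrK -addrA.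
    have d2 : 2 * dx N != 0 :> R by rewrite mulf_neq0 // gt_eqF.
    by move/(mulIf (invr_neq0 d2)); rewrite /d => e; apply/eqP; rewrite subr_eq; apply/eqP;
      move/eqP: e; rewrite subr_eq => /eqP ->; ring.
  have dc n : ~~ even_node 0 n -> d n = d 1.
    move=> on; have -> : n = 1 + 2%N%:Z * divz n 2 by move: on; rewrite /even_node; clear; lia.
    apply: (@int_periodic R (fun n => ~~ even_node 0 n) d 2) => //.
    by move=> p; rewrite /even_node; clear; lia.
  have := averaged_balance N0 K0 vP vE; rewrite avE subrr mulr0.
  rewrite (eq_bigl (fun m : nat => ~~ even_node 0 m%:Z)); last first.
    by move=> n; rewrite -[(2 * K)%N]add0n even_node_time_period.
  rewrite -sumrB (eq_bigr (fun _ => d 1)); last by move=> n on; exact: dc.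
  rewrite (eq_bigl (fun m : nat => even_node 1 m%:Z)); last first.
    by move=> n; rewrite /even_node; clear; lia.
  rewrite sum_even_nodes => /eqP; rewrite mulf_eq0 pnatr_eq0 (gtn_eqF N0) /= => /eqP d1 om.
  by apply/eqP; rewrite -subr_eq0 -/(d m) dc // d1.
have vt := time_periodic_of_period (ham_torus_periodic H_ass) K0 vE v2K.
have odd1 : [set m : int | ~~ even_node 0 m] !=set0 by exists 1.
have Smc := mcshane_eq odd1 Slip r0.
apply: huniq; exists (mcshane [set m : int | ~~ even_node 0 m] (xg N) S r), v; split => //.
split => //.
- by apply/hj_equationP.
- apply: Lip_of_le; last exact: mcshane_lipschitz.
  move=> x; rewrite /mcshane; congr sup; apply/seteqP; split => _ [m om <-].
    exists (m - (2 * N)%N%:Z); first by rewrite /= -(even_node_period N) subrK.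
    have -> : xg N (m - (2 * N)%N%:Z) = xg N m - 1 :> R.
      by rewrite -[in RHS](subrK (2 * N)%N%:Z m) xg_period // addrK.
    have -> : S (m - (2 * N)%N%:Z) = S m.
      by rewrite -[in RHS](subrK (2 * N)%N%:Z m) /S primitive_periodic.
    by congr (_ - _ * `|_|); ring.
  exists (m + (2 * N)%N%:Z); first by rewrite /= even_node_period.
  have -> : xg N (m + (2 * N)%N%:Z) = xg N m + 1 :> R by exact: xg_period.
  have -> : S (m + (2 * N)%N%:Z) = S m by exact: primitive_periodic.
  by congr (_ - _ * `|_|); ring.
- move=> m em; rewrite Smc //=; have [_ nd] := even_pred_succ em; exact: nd.
Qed.
End one_mesh.

(** * Doubling of variables *)

Section quadratic_penalty.
Context {R : realType}.
Implicit Types (e : R) (y z : R * R).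

(** For a quadratic function the increment along a line is an exact polynomial, from
    which the derivative is read off. *)
Lemma derive_of_quadratic_increment (V : normedModType R) (f : V -> R) (z d : V) (A Q : R) :
  (forall h : R, f (h *: d + z) - f z = h * A + h ^+ 2 * Q) ->
  derivable f z d /\ 'D_d f z = A.
Proof.
move=> hf; have lim_q : h^-1 *: ((f \o shift z) (h *: d) - f z) @[h --> (0 : R)^'] --> A.
  apply/cvgrPdist_le => e e0; rewrite /dnbhs near_withinE.
  apply/nbhs_ballP; exists (e / (`|Q| + 1)) => [|h]; first by rewrite /= divr_gt0 // ltr_wpDl.
  rewrite /ball /= sub0r normrN => he hn0; rewrite hf.
  have -> : A - h^-1 *: (h * A + h ^+ 2 * Q) = - (h * Q).
    by rewrite /GRing.scale /= expr2; field.
  rewrite normrN normrM; rewrite ltr_pdivlMr ?ltr_wpDl // in he.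
  apply: le_trans (ltW he); rewrite ler_wpM2l // lerDl //.
by split; [apply/cvg_ex; exists A | exact/cvg_lim].
Qed.

Definition penalty e y z : R := ((z.1 - y.1) ^+ 2 + (z.2 - y.2) ^+ 2) / (2 * e).

Lemma penalty_continuous e y : continuous (penalty e y).
Proof.
move=> z; apply: cvgMl; apply: cvgD; apply: cvgM; apply: cvgB;
  by [exact: cvg_cst | exact: cvg_fst | exact: cvg_snd].
Qed.

Lemma penalty_derive (s e : R) y z d : 0 < e ->
  derivable (fun z => s * penalty e y z) z d /\
  'D_d (fun z => s * penalty e y z) z
  = s * (((z.1 - y.1) / e) * d.1 + ((z.2 - y.2) / e) * d.2).
Proof.
move=> e0; apply: (derive_of_quadratic_increment
  (Q := s * (d.1 ^+ 2 + d.2 ^+ 2) / (2 * e))) => h.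
by rewrite /penalty /= /GRing.scale /=; field; rewrite gt_eqF.
Qed.

Lemma penalty_C1 (s e : R) y : 0 < e -> Ck 1 (fun z => s * penalty e y z).
Proof.
move=> e0; split=> [z|d]; first by apply: cvgMr; exact: penalty_continuous.
split=> [z|]; first by have [] := penalty_derive s y z d e0.
split => //.
rewrite (_ : (fun z => 'D_d _ z) = (fun z : R * R =>
    s * (((z.1 - y.1) / e) * d.1 + ((z.2 - y.2) / e) * d.2))); last first.
  by apply/funext => z; have [_ ->] := penalty_derive s y z d e0.
move=> z; apply: cvgMr; apply: cvgD; apply: cvgMl; apply: cvgMl; apply: cvgB;
  by [exact: cvg_cst | exact: cvg_fst | exact: cvg_snd].
Qed.

Lemma penalty_partial_x (s e : R) y z : 0 < e ->
  partial_x (fun z => s * penalty e y z) z = s * ((z.1 - y.1) / e).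
Proof.
move=> e0; rewrite /partial_x derive1E.
have [] := @derive_of_quadratic_increment R (fun x => s * penalty e y (x, z.2)) z.1 1
  (s * ((z.1 - y.1) / e)) (s / (2 * e)) => [h|_ -> //].
by rewrite /penalty /= /GRing.scale /=; field; rewrite gt_eqF.
Qed.

Lemma penalty_partial_t (s e : R) y z : 0 < e ->
  partial_t (fun z => s * penalty e y z) z = s * ((z.2 - y.2) / e).
Proof.
move=> e0; rewrite /partial_t derive1E.
have [] := @derive_of_quadratic_increment R (fun t => s * penalty e y (z.1, t)) z.2 1
  (s * ((z.2 - y.2) / e)) (s / (2 * e)) => [h|_ -> //].
by rewrite /penalty /= /GRing.scale /=; field; rewrite gt_eqF.
Qed.

(** Far from y the penalty is at least the oscillation of w, so a maximum over a large
    box is global. *)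
Lemma sup_convolution_attained (w : R * R -> R) (C e : R) y : 0 < e ->
  continuous w -> (forall z, `|w z| <= C) ->
  exists z, forall z', w z' - penalty e y z' <= w z - penalty e y z.
Proof.
move=> e0 wc wC; have C0 : 0 <= C := le_trans (normr_ge0 _) (wC y).
(* rho >= 1 gives rho ^ 2 >= rho >= 4 e C, so the penalty is at least 2 C
   outside the box. *)
pose rho := 1 + 4 * e * C.
have rho1 : 1 <= rho by rewrite lerDl !mulr_ge0 // ltW.
have rho0 : 0 <= rho by apply: le_trans rho1.
pose A := `[y.1 - rho, y.1 + rho]%classic `*` `[y.2 - rho, y.2 + rho]%classic : set (R * R).
have Ay : A y by split; rewrite /= in_itv /=; apply/andP; split; lra.
have cA : compact A by apply: compact_setX; exact: segment_compact.
have cf : {within A, continuous (fun z => w z - penalty e y z)}.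
  apply: continuous_subspaceT => z.
  by apply: cvgB; [exact: wc | exact: penalty_continuous].
have [z _ zmax] := @compact_EVT_max _ R _ A (ex_intro _ y Ay) cA cf.
exists z => z'; have [Az'|nA] := pselect (A z'); first by apply: zmax; rewrite inE.
have wy : - C <= w z - penalty e y z.
  apply: le_trans (zmax y _); last by rewrite inE.
  rewrite /penalty !subrr expr0n addr0 mul0r subr0.
  by have := wC y; rewrite ler_norml => /andP[].
apply: le_trans wy.
have far (b : R) : rho < `|b| -> 4 * e * C <= b ^+ 2.
  move=> rb; rewrite -real_normK ?num_real // expr2.
  have : rho * rho <= `|b| * `|b| by apply: ler_pM => //; exact: ltW.
  apply: le_trans; apply: (@le_trans _ _ (rho * 1)); last by rewrite ler_wpM2l.
  by rewrite mulr1 /rho; lra.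
have big : 4 * e * C <= (z'.1 - y.1) ^+ 2 + (z'.2 - y.2) ^+ 2.
  have [h1|h1] := leP `|z'.1 - y.1| rho; last first.
    by apply: le_trans (far _ h1) _; rewrite lerDl sqr_ge0.
  have [h2|h2] := leP `|z'.2 - y.2| rho; last first.
    by apply: le_trans (far _ h2) _; rewrite lerDr sqr_ge0.
  case: nA; split; rewrite /= in_itv /=.
    by move: h1; rewrite ler_norml => /andP[? ?]; apply/andP; split; lra.
  by move: h2; rewrite ler_norml => /andP[? ?]; apply/andP; split; lra.
have : 2 * C <= penalty e y z'.
  rewrite /penalty ler_pdivlMr ?mulr_gt0 //; lra.
by have := wC z'; rewrite ler_norml => /andP[_ ?]; lra.
Qed.
End quadratic_penalty.

Section doubling.
Context {R : realType} (N K : nat) (N0 : (0 < N)%N) (K0 : (0 < K)%N).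

Definition node k m : R * R := (xg N m, tg K k).

(** Maximizes w z - F - penalty jointly over nodes and points. The supremum over z is
    attained and doubly periodic in the node, hence the maximum over nodes is
    attained too, at a node which is not on the initial level. *)
Lemma doubling_variables (w : R * R -> R) (F : nat -> int -> R) (e : R) : 0 < e ->
  continuous w -> (forall t, periodic (fun x => w (x, t)) 1) ->
  (forall x, periodic (fun t => w (x, t)) 1) -> doubly_periodic N K F ->
  exists k m z, [/\ even_node k m,
    forall z', w z' - penalty e (node k.+1 m) z' <= w z - penalty e (node k.+1 m) z &
    forall k' m', ~~ even_node k' m' ->
      F k.+1 m + penalty e (node k.+1 m) z <= F k' m' + penalty e (node k' m') z].
Proof.
move=> e0 wc wx wt [Fx Ft].
have [C C0 wC] : exists2 C, 0 < C & forall z, `|w z| <= C.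
  have [||C C0 hC] := @strip_bounded R (fun x t _ => w (x, t)) 1.
  - by split => x t _; [exact: wx | exact: wt].
  - move=> z; rewrite (_ : on_R3 _ = w \o fst).
      by apply: continuous_comp; [exact: cvg_fst | exact: wc].
    by apply/funext => -[[x t] p].
  by exists C => // -[x t]; apply: (hC x t 0); rewrite normr0.
have [zs zsmax] := choice (fun y => sup_convolution_attained y e0 wc wC).
pose S y := w (zs y) - penalty e y (zs y).
have shift_le (y d : R * R) : (forall z, w (z + d) = w z) -> S (y + d) = S y.
  move=> wd; have pen z : penalty e (y + d) (z + d) = penalty e y z.
    by rewrite /penalty /=; congr ((_ ^+ 2 + _ ^+ 2) / _); ring.
  apply: le_anti; apply/andP; split; rewrite /S.
    have := zsmax y (zs (y + d) - d).
    by rewrite -[w (_ - d)]wd -[penalty e y _]pen subrK.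
  by have := zsmax (y + d) (zs y + d); rewrite wd pen.
have w1 z : w (z + (1, 0)) = w z.
  by case: z => x t; rewrite -[in RHS](wx t x); congr w; apply/eqP; rewrite xpair_eqE /= addr0 !eqxx.
have w2 z : w (z + (0, 1)) = w z.
  by case: z => x t; rewrite -[in RHS](wt x t); congr w; apply/eqP; rewrite xpair_eqE /= addr0 !eqxx.
have [||k [m [_ om Gmax]]] := @grid_argmax R N K (fun k m => S (node k m) - F k m) N0 K0.
- move=> k m om; rewrite Fx //; congr (_ - _); rewrite -[RHS](shift_le _ _ w1); congr S.
  by apply/eqP; rewrite xpair_eqE /= xg_period // addr0 !eqxx.
- move=> k m om; rewrite Ft //; congr (_ - _); rewrite -[RHS](shift_le _ _ w2); congr S.
  by apply/eqP; rewrite xpair_eqE /= tg_period // addr0 !eqxx.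
exists k, m, (zs (node k.+1 m)); split; first by rewrite -even_node_S.
  exact: zsmax.
move=> k' m' om'; have := Gmax k' m' om'; have := zsmax (node k' m') (zs (node k.+1 m)).
by rewrite /S; lra.
Qed.
End doubling.

Section penalty_at_nodes.
Context {R : realType} (N K : nat) (k : nat) (m : int) (e : R) (z : R * R).
Hypothesis e0 : 0 < e.

Let p := (z.1 - xg N m) / e.
Let q := (z.2 - tg K k.+1) / e.

Lemma penalty_previous (j : int) : j = 1 \/ j = -1 ->
  penalty e (node N K k (m + j)) z = penalty e (node N K k.+1 m) z
    - j%:~R * p * dx N + q * dt K + (dx N ^+ 2 + dt K ^+ 2) / (2 * e).
Proof.
move=> j1; have jj : j%:~R ^+ 2 = 1 :> R by case: j1 => ->; rewrite ?expr1n // sqrrN expr1n.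
rewrite /p /q /penalty /node /= xgD tgS.
have -> : dx N ^+ 2 = j%:~R ^+ 2 * dx N ^+ 2 :> R by rewrite jj mul1r.
by field; rewrite gt_eqF.
Qed.

Lemma penalty_neighbor (j : int) : j = 1 \/ j = -1 ->
  penalty e (node N K k.+1 (m + 2 * j)) z = penalty e (node N K k.+1 m) z
    - 2 * j%:~R * p * dx N + 2 * dx N ^+ 2 / e.
Proof.
move=> j1; have jj : j%:~R ^+ 2 = 1 :> R by case: j1 => ->; rewrite ?expr1n // sqrrN expr1n.
rewrite /p /penalty /node /= xgD intrM -[2%:~R]/(2%:R).
have -> : dx N ^+ 2 = j%:~R ^+ 2 * dx N ^+ 2 :> R by rewrite jj mul1r.
by field; rewrite gt_eqF.
Qed.
End penalty_at_nodes.

Lemma periodic_max (R : realType) (w : R * R -> R) : continuous w ->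
  (forall t, periodic (fun x => w (x, t)) 1) -> (forall x, periodic (fun t => w (x, t)) 1) ->
  exists z, forall z', w z' <= w z.
Proof.
move=> wc wx wt.
pose A := `[0, 1]%classic `*` `[0, 1]%classic : set (R * R).
have A0 : A (0, 0) by split; rewrite /= in_itv /= lexx ler01.
have cA : compact A by apply: compact_setX; exact: segment_compact.
have [z _ zmax] := @compact_EVT_max _ R w A (ex_intro _ _ A0) cA (continuous_subspaceT wc).
exists z => -[x t].
rewrite -(periodic_frac x (g := fun y => w (y, t))) // -(periodic_frac t (g := fun s => w (_, s))) //.
apply: zmax; rewrite inE.
by split; rewrite /= in_itv /= frac_itv01.
Qed.

Section viscosity_tests.
Context {R : realType} (H : R -> R -> R -> R) (c h : R) (v : R -> R -> R).
Hypothesis vh : periodic_viscosity_solution H c h v.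

Lemma sub_penalty_test (s e : R) y z : 0 < e ->
  (forall z', v z'.1 z'.2 - s * penalty e y z' <= v z.1 z.2 - s * penalty e y z) ->
  s * ((z.2 - y.2) / e) + H z.1 z.2 (c + s * ((z.1 - y.1) / e)) <= h.
Proof.
move=> e0 zmax; rewrite -(penalty_partial_x _ _ z e0) -(penalty_partial_t _ _ z e0).
by apply: (visc_sub vh); [exact: penalty_C1 | exact: (@filterE _ (nbhs z) (nbhs_filter z) _ zmax)].
Qed.

Lemma super_penalty_test (s e : R) y z : 0 < e ->
  (forall z', v z.1 z.2 - s * penalty e y z <= v z'.1 z'.2 - s * penalty e y z') ->
  h <= s * ((z.2 - y.2) / e) + H z.1 z.2 (c + s * ((z.1 - y.1) / e)).
Proof.
move=> e0 zmin; rewrite -(penalty_partial_x _ _ z e0) -(penalty_partial_t _ _ z e0).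
by apply: (visc_super vh); [exact: penalty_C1 | exact: (@filterE _ (nbhs z) (nbhs_filter z) _ zmin)].
Qed.

(** Constant test functions at a maximum and a minimum of v; they are penalties with
    factor 0. *)
Lemma exact_effective_bound (C : R) : (forall x t, `|H x t c| <= C) -> `|h| <= C.
Proof.
move=> HC; have vc := visc_continuous vh.
have [[x t] zmax] := periodic_max vc (visc_periodic_x vh) (visc_periodic_t vh).
have [[y s] zmin] := @periodic_max _ (fun z => - v z.1 z.2) (fun z => continuousN (@vc z))
  (fun t => (fun x => congr1 -%R (visc_periodic_x vh t x)))
  (fun x => (fun t => congr1 -%R (visc_periodic_t vh x t))).
have := @sub_penalty_test 0 1 (0, 0) (x, t) ltr01.
rewrite !mul0r add0r addr0 /= => hsub.
have := @super_penalty_test 0 1 (0, 0) (y, s) ltr01.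
rewrite !mul0r add0r addr0 /= => hsup.
have {}hsub : H x t c <= h.
  by apply: hsub => z'; rewrite !mul0r !subr0; exact: (zmax z').
have {}hsup : h <= H y s c.
  by apply: hsup => z'; rewrite !mul0r !subr0 -lerN2; exact: (zmin z').
have := HC x t; have := HC y s; rewrite !ler_norml => /andP[? ?] /andP[? ?].
by apply/andP; split; lra.
Qed.
End viscosity_tests.

(** * Error estimate *)

Section error_estimate.
Context {R : realType} (H : R -> R -> R -> R) (H_ass : hamiltonian_assumptions H).
Context (N K : nat) (N0 : (0 < N)%N) (NK : (N <= K)%N) (B : R)
  (cfl1 : B * (dt K / dx N) < 1).
Context (c hD : R) (V : nat -> int -> R) (solV : periodic_solution H N K B c hD V).

Let K0 : (0 < K)%N := leq_trans N0 NK.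
Let dx0 : 0 < dx N :> R := dx_gt0 N0.
Let dt0 : 0 < dt K :> R := dt_gt0 K0.

Section one_node.
Context (e : R) (e0 : 0 < e) (k : nat) (m : int) (z : R * R) (em : even_node k m).

Let P := (z.1 - xg N m) / e.
Let Q := (z.2 - tg K k.+1) / e.
Let rest := (dx N ^+ 2 + dt K ^+ 2) / (2 * e).

(** The penalty at neighbouring nodes is explicit, so touching bounds the increments
    of F to the two predecessors and to the two neighbours on the same level. *)
Lemma touching_increments (F : nat -> int -> R) :
  (forall k' m', ~~ even_node k' m' ->
    F k.+1 m + penalty e (node N K k.+1 m) z <= F k' m' + penalty e (node N K k' m') z) ->
  [/\ F k.+1 m + P * dx N - Q * dt K - rest <= F k (m + 1),
      F k.+1 m - P * dx N - Q * dt K - rest <= F k (m - 1),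
      F k.+1 m + 2 * P * dx N - 2 * dx N ^+ 2 / e <= F k.+1 (m + 1 + 1) &
      F k.+1 m - 2 * P * dx N - 2 * dx N ^+ 2 / e <= F k.+1 (m - 1 - 1)].
Proof.
move=> touch; have [nd1 nd2] := even_pred_succ em.
have nd3 : ~~ even_node k.+1 (m + 2 * 1) by move: em; rewrite /even_node; clear; lia.
have nd4 : ~~ even_node k.+1 (m + 2 * -1) by move: em; rewrite /even_node; clear; lia.
have := touch _ _ nd1; have := touch _ _ nd2; have := touch _ _ nd3; have := touch _ _ nd4.
rewrite !penalty_neighbor ?penalty_previous //; try by [left | right].
rewrite -/P -/Q -/rest -!addrA (_ : 2 * 1 = 1 + 1) // (_ : 2 * -1 = -1 - 1) //.
rewrite (_ : 1%:~R = 1 :> R) // (_ : (-1)%:~R = -1 :> R) //.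
by move=> h4 h3 h2 h1; split; lra.
Qed.

(** With a, b >= 0 the excesses over the penalty at the two predecessors, the scheme
    reads hD = H(c + DV) - (a + b)/(2 dt) + Q + rest/dt with DV = P + (a - b)/(2 dx).
    The tangent of H at c + DV bounds the gain H(c + DV) - H(c + P) by
    B (a + b)/(2 dx), which (a + b)/(2 dt) absorbs. *)
Lemma touching_below :
  (forall k' m', ~~ even_node k' m' ->
    V k.+1 m + penalty e (node N K k.+1 m) z <= V k' m' + penalty e (node N K k' m') z) ->
  [/\ slope N V k.+1 (m - 1) - dx N / e <= P,
      P <= slope N V k.+1 (m + 1) + dx N / e &
      hD <= H (xg N m) (tg K k) (c + P) + Q + rest / dt K].
Proof.
move=> /touching_increments[h1 h2 h3 h4]; have [_ VB hV] := solV.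
have d2 : 0 < 2 * dx N :> R by rewrite mulr_gt0.
split.
- rewrite lerBlDr /slope subrK ler_pdivrMr //.
  have -> : (P + dx N / e) * (2 * dx N) = 2 * P * dx N + 2 * dx N ^+ 2 / e by ring.
  by lra.
- rewrite -lerBlDr /slope addrK ler_pdivlMr //.
  have -> : (P - dx N / e) * (2 * dx N) = 2 * P * dx N - 2 * dx N ^+ 2 / e by ring.
  by lra.
have := hV _ _ em; have := VB _ _ em.
have := H_p_tangent H_ass (xg N m) (tg K k) (c + slope N V k m) (c + P).
set Hd := H _ _ (c + slope N V k m); set s := H_p _ _ _ _ => tang sB sch.
pose a := V k (m + 1) - (V k.+1 m + P * dx N - Q * dt K - rest).
pose b := V k (m - 1) - (V k.+1 m - P * dx N - Q * dt K - rest).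
have a0 : 0 <= a by rewrite subr_ge0.
have b0 : 0 <= b by rewrite subr_ge0.
have slE : c + P - (c + slope N V k m) = - ((a - b) / (2 * dx N)).
  by rewrite /slope /a /b; field; rewrite gt_eqF.
have hDE : hD = Hd - (a + b) / (2 * dt K) + Q + rest / dt K.
  have e1 : dt K * (Hd - hD) = (a + b) / 2 - Q * dt K - rest.
    by rewrite /a /b; move: sch; lra.
  have -> : hD = Hd - (dt K * (Hd - hD)) / dt K by field; rewrite gt_eqF.
  by rewrite e1; field; rewrite gt_eqF.
have key : s * ((a - b) / (2 * dx N)) <= (a + b) / (2 * dt K).
  apply: le_trans (ler_norm _) _; rewrite normrM.
  have ab : `|(a - b) / (2 * dx N)| <= (a + b) / (2 * dx N).
    rewrite normrM (gtr0_norm (_ : 0 < (2 * dx N)^-1)) ?invr_gt0 //.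
    rewrite ler_wpM2r ?invr_ge0 ?(ltW d2) // ler_norml; apply/andP; split; lra.
  apply: le_trans (ler_pM _ _ sB ab) _ => //.
  have -> : B * ((a + b) / (2 * dx N)) = B * (dt K / dx N) * ((a + b) / (2 * dt K)).
    by field; rewrite !gt_eqF.
  apply: ler_piMl; last exact: ltW.
  by apply: divr_ge0; [exact: addr_ge0 | rewrite mulr_ge0 // ltW].
by move: tang; rewrite slE mulrN hDE; move: key; lra.
Qed.

(** As [touching_below] with opposite signs, but the tangent is now taken at c - P,
    where the bound B holds only up to eta. The unabsorbed part is eta times
    S = (a + b)/(2 dt), and the scheme expresses S by bounded quantities. *)
Lemma touching_above :
  (forall k' m', ~~ even_node k' m' ->
    - V k.+1 m + penalty e (node N K k.+1 m) z <= - V k' m' + penalty e (node N K k' m') z) ->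
  [/\ slope N V k.+1 (m + 1) - dx N / e <= - P,
      - P <= slope N V k.+1 (m - 1) + dx N / e &
      exists2 S, 0 <= S /\ S = hD - H (xg N m) (tg K k) (c + slope N V k m) + Q + rest / dt K &
      forall eta, 0 <= eta -> `|H_p H (xg N m) (tg K k) (c - P)| <= B + eta ->
        H (xg N m) (tg K k) (c - P) - Q - rest / dt K - eta * S <= hD].
Proof.
move=> /(touching_increments (F := fun k m => - V k m))[h1 h2 h3 h4]; have [_ VB hV] := solV.
have d2 : 0 < 2 * dx N :> R by rewrite mulr_gt0.
split.
- rewrite lerBlDr /slope addrK ler_pdivrMr //.
  have -> : (- P + dx N / e) * (2 * dx N) = - (2 * P * dx N) + 2 * dx N ^+ 2 / e by ring.
  by lra.
- rewrite -lerBlDr /slope subrK ler_pdivlMr //.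
  have -> : (- P - dx N / e) * (2 * dx N) = - (2 * P * dx N) - 2 * dx N ^+ 2 / e by ring.
  by lra.
have sch := hV _ _ em.
have := H_p_tangent H_ass (xg N m) (tg K k) (c - P) (c + slope N V k m).
set Hd := H _ _ (c + slope N V k m); set s := H_p _ _ _ _ => tang.
rewrite -/Hd in sch.
pose a := - V k (m + 1) - (- V k.+1 m + P * dx N - Q * dt K - rest).
pose b := - V k (m - 1) - (- V k.+1 m - P * dx N - Q * dt K - rest).
have a0 : 0 <= a by rewrite subr_ge0.
have b0 : 0 <= b by rewrite subr_ge0.
have slE : c + slope N V k m - (c - P) = - ((a - b) / (2 * dx N)).
  by rewrite /slope /a /b; field; rewrite gt_eqF.
have SE : (a + b) / (2 * dt K) = hD - Hd + Q + rest / dt K.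
  have e1 : dt K * (hD - Hd) = (a + b) / 2 - Q * dt K - rest.
    by rewrite /a /b; move: sch; lra.
  have -> : hD - Hd = (dt K * (hD - Hd)) / dt K by field; rewrite gt_eqF.
  by rewrite e1; field; rewrite gt_eqF.
have S0 : 0 <= (a + b) / (2 * dt K).
  by apply: divr_ge0; [exact: addr_ge0 | rewrite mulr_ge0 // ltW].
exists ((a + b) / (2 * dt K)) => // eta eta0 sB.
have key : s * ((a - b) / (2 * dx N)) <= (1 + eta) * ((a + b) / (2 * dt K)).
  apply: le_trans (ler_norm _) _; rewrite normrM.
  have ab : `|(a - b) / (2 * dx N)| <= (a + b) / (2 * dx N).
    rewrite normrM (gtr0_norm (_ : 0 < (2 * dx N)^-1)) ?invr_gt0 //.
    rewrite ler_wpM2r ?invr_ge0 ?(ltW d2) // ler_norml; apply/andP; split; lra.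
  apply: le_trans (ler_pM _ _ sB ab) _ => //.
  have -> : (B + eta) * ((a + b) / (2 * dx N)) =
      (B * (dt K / dx N) + eta * (dt K / dx N)) * ((a + b) / (2 * dt K)).
    by field; rewrite !gt_eqF.
  apply: ler_wpM2r => //; apply: lerD; first exact: ltW.
  apply: ler_piMr => //; rewrite ler_pdivrMr // mul1r /dt /dx lef_pV2 ?posrE;
    by rewrite ?ler_pM2l ?ler_nat // mulr_gt0 // ltr0n.
move: tang; rewrite slE mulrN; move: key SE; rewrite [(1 + eta) * _]mulrDl mul1r.
by move: ((a + b) / (2 * dt K)) => S; lra.
Qed.
End one_node.
End error_estimate.

(** The scheme at a maximum and at a minimum of V. *)
Lemma discrete_effective_bound (R : realType) (H : R -> R -> R -> R) N K (B c hD C : R) V :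
  (0 < N)%N -> (0 < K)%N -> periodic_solution H N K B c hD V ->
  (forall k m, even_node k m -> `|H (xg N m) (tg K k) (c + slope N V k m)| <= C) ->
  `|hD| <= C.
Proof.
move=> N0 K0 [[Vx Vt] _ hV] HC; have dt0 : 0 < dt K :> R := dt_gt0 K0.
have [k [m [_ om vmax]]] := grid_argmax N0 K0 Vx Vt.
have [||l [n [_ on vmin]]] := @grid_argmax R N K (fun k m => - V k m) N0 K0.
- by move=> *; rewrite Vx.
- by move=> *; rewrite Vt.
rewrite even_node_S in om; rewrite even_node_S in on.
have [nd1 nd2] := even_pred_succ om; have [nd3 nd4] := even_pred_succ on.
have := HC _ _ om; have := HC _ _ on; rewrite !ler_norml => /andP[_ a2] /andP[a1 _].
have := hV _ _ om; have := hV _ _ on => e1 e2.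
have := vmax _ _ nd1; have := vmax _ _ nd2; have := vmin _ _ nd3; have := vmin _ _ nd4.
move: e1 e2 a1 a2; set X := H _ _ _; set Y := H _ _ _ => e1 e2 a1 a2 b1 b2 b3 b4.
have h1 : 0 <= dt K * (hD - Y) by rewrite mulrBr; lra.
have h2 : 0 <= dt K * (X - hD) by rewrite mulrBr; lra.
rewrite pmulr_rge0 // in h1; rewrite pmulr_rge0 // in h2.
by apply/andP; split; lra.
Qed.

Lemma effective_error (R : realType) (H : R -> R -> R -> R) (B lam0 Cc : R) :
  hamiltonian_assumptions H -> 0 <= B -> 0 < lam0 -> 0 <= Cc ->
  exists2 beta, 0 < beta & forall N K, (0 < N <= K)%N -> lam0 <= dt K / dx N ->
    B * (dt K / dx N) < 1 -> forall c, `|c| <= Cc ->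
    forall hD V, periodic_solution H N K B c hD V ->
    forall h v, periodic_viscosity_solution H c h v ->
    `|hD - h| <= beta * Num.sqrt (dx N).
Proof.
move=> H_ass B0 lam00 Cc0.
have [M M0 hM] := H_p_coercive H_ass B.
(* Slopes u of V satisfy |c + u| <= M and the tested slope p lies between two of
   them up to 1; the summand Cc covers p itself and c. *)
pose M2 := M + 1 + Cc.
have M20 : 0 < M2 by rewrite /M2; lra.
have HC1 : Ck 1 (on_R3 H) by apply: Ck_pred; exact: on_R3_C2.
have [HM HM0 hHM] := strip_bounded M2 (ham_torus_periodic H_ass) (proj1 (on_R3_C2 H_ass)).
have [L L0 hL] := strip_lipschitz M2 (ham_torus_periodic H_ass) HC1.
have [L' L'0 hL'] := strip_lipschitz M2 (H_p_torus_periodic H_ass) (on_R3_H_p_C1 H_ass).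
pose Ce : R := (lam0^-1 + 1) / 2.
have Ce0 : 0 < Ce by rewrite divr_gt0 // addr_gt0 // invr_gt0.
(* Qm bounds the time derivative of the penalty, through either equation. *)
pose Qm := 2 * HM + Ce.
pose beta := L * (M2 + Qm + 1) + Ce + 3 * L' * (2 * HM + Qm + Ce).
have Qm0 : 0 < Qm by rewrite /Qm; lra.
have t1 : 0 < L * (M2 + Qm + 1) by rewrite mulr_gt0 //; lra.
have t2 : 0 < 3 * L' * (2 * HM + Qm + Ce) by rewrite !mulr_gt0 //; lra.
exists beta; first by rewrite /beta; lra.
move=> N K /andP[N0 NK] lamge cfl1 c cC hD V solV h v vh.
have K0 : (0 < K)%N := leq_trans N0 NK.
have dx0 : 0 < dx N :> R := dx_gt0 N0.
have dt0 : 0 < dt K :> R := dt_gt0 K0.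
have dt_dx : dt K <= dx N :> R.
  by rewrite /dt /dx lef_pV2 ?posrE ?ler_pM2l ?ler_nat // mulr_gt0 // ltr0n.
set s := Num.sqrt (dx N).
have s0 : 0 < s by rewrite sqrtr_gt0.
have ss : s * s = dx N by rewrite -expr2 sqr_sqrtr // ltW.
have s1 : s <= 1.
  rewrite -sqrtr1 ler_sqrt // /dx invf_le1 ?mulr_gt0 ?ltr0n //.
  by have : 1 <= N%:R :> R; [rewrite ler1n | lra].
have dx_s : dx N <= s by rewrite -ss; apply: ler_piMr => //; exact: ltW.
have dxs : dx N / s = s by rewrite -ss mulfK // gt_eqF.
have restE : (dx N ^+ 2 + dt K ^+ 2) / (2 * s) / dt K <= Ce * s.
  have -> : (dx N ^+ 2 + dt K ^+ 2) / (2 * s) / dt K =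
      (dx N / s * (dt K / dx N)^-1 + dt K / s) / 2 by field; rewrite !gt_eqF.
  rewrite dxs; have : (dt K / dx N)^-1 <= lam0^-1 by rewrite lef_pV2 // posrE divr_gt0.
  have : dt K / s <= s by rewrite -[leRHS]dxs ler_wpM2r // invr_ge0 ltW.
  move: (_^-1) (dt K / s) => x y hy hx; rewrite /Ce.
  have : s * x <= s * lam0^-1 by rewrite ler_wpM2l // ltW.
  by lra.
have rest0 : 0 <= (dx N ^+ 2 + dt K ^+ 2) / (2 * s) / dt K.
  by rewrite !divr_ge0 ?addr_ge0 ?sqr_ge0 ?mulr_ge0 // ltW.
have Ces : Ce * s <= Ce by apply: ler_piMr => //; exact: ltW.
have VM k m : even_node k m -> `|c + slope N V k m| <= M.
  by move=> em; apply: (hM (xg N m) (tg K k)); have [_ VB _] := solV; exact: VB.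
have MM2 (x : R) : `|x| <= M -> `|x| <= M2 by move=> xM; apply: le_trans xM _; rewrite /M2; clear -Cc0; lra.
have hDb : `|hD| <= HM.
  by apply: (discrete_effective_bound N0 K0 solV) => k m em; apply: hHM; exact/MM2/VM.
have hb : `|h| <= HM.
  apply: (exact_effective_bound vh) => x t; apply: hHM.
  by apply: le_trans cC _; rewrite /M2; clear -M0; lra.
have small p u1 u2 : `|c + u1| <= M -> `|c + u2| <= M -> u1 - s <= p -> p <= u2 + s ->
    `|c + p| <= M2 /\ `|p| <= M2.
  clear -cC s0 s1 Cc0; move: cC; rewrite /M2 !ler_norml => /andP[? ?] /andP[? ?] /andP[? ?] ? ?.
  by split; apply/andP; split; lra.
have near_point (z : R * R) k m p q : `|z.1 - xg N m| = s * `|p| -> z.2 - tg K k.+1 = s * q ->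
    `|c + p| <= M2 -> `|p| <= M2 -> `|q| <= Qm -> forall p', p' = c + p ->
    `|H (xg N m) (tg K k) p' - H z.1 z.2 p'| <= L * (M2 + Qm + 1) * s.
  move=> zx zt cp pM qM _ ->; apply: le_trans (hL _ _ _ _ _ _ cp cp) _.
  rewrite subrr normr0 addr0 -mulrA ler_wpM2l // ?(ltW L0) //.
  have -> : tg K k - z.2 = - (s * q + dt K) by rewrite -zt tgS; ring.
  rewrite normrN [`|xg N m - z.1|]distrC zx.
  apply: le_trans (lerD (lexx _) (ler_normD _ _)) _.
  rewrite normrM (gtr0_norm s0) (gtr0_norm dt0).
  have := ler_wpM2l (ltW s0) pM; have := ler_wpM2l (ltW s0) qM.
  by clear -dt_dx dx_s; move: dt_dx dx_s; lra.
have [wcx wct] := (visc_periodic_x vh, visc_periodic_t vh).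
have upper : hD - h <= beta * s.
  have [k [m [z [em hz touch]]]] := @doubling_variables R N K N0 K0
    (fun z => v z.1 z.2) V s s0 (visc_continuous vh) wcx wct (let: And3 p _ _ := solV in p).
  have := touching_below H_ass N0 NK cfl1 solV s0 em touch.
  have : forall z', v z'.1 z'.2 - 1 * penalty s (node N K k.+1 m) z'
      <= v z.1 z.2 - 1 * penalty s (node N K k.+1 m) z.
    by move=> z'; rewrite !mul1r; exact: hz.
  move/(sub_penalty_test vh s0); rewrite !mul1r /=.
  set P := (z.1 - _) / s; set Q := (z.2 - _) / s => hsub.
  have zx : `|z.1 - xg N m| = s * `|P|.
    by rewrite /P normrM normfV (gtr0_norm s0) mulrC divfK // gt_eqF.
  have zt : z.2 - tg K k.+1 = s * Q by rewrite /Q mulrC divfK // gt_eqF.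
  rewrite dxs => -[p1 p2 hdisc].
  have em1 : even_node k.+1 (m - 1) by move: em; rewrite /even_node; clear; lia.
  have em2 : even_node k.+1 (m + 1) by move: em; rewrite /even_node; clear; lia.
  have [cP PM] := small _ _ _ (VM _ _ em1) (VM _ _ em2) p1 p2.
  have H1 := hHM (xg N m) (tg K k) _ cP; have H2 := hHM z.1 z.2 _ cP.
  have QM : `|Q| <= Qm.
    clear -H1 H2 hDb hb hsub hdisc restE rest0 Ces Ce0 HM0.
    move: H1 H2 hDb hb; rewrite /Qm !ler_norml => /andP[? ?] /andP[? ?] /andP[? ?] /andP[? ?].
    by apply/andP; split; lra.
  have := near_point z k m P Q zx zt cP PM QM _ erefl.
  rewrite ler_norml => /andP[_ hn].
  have := mulr_ge0 (ltW t2) (ltW s0); clear -hn hsub hdisc restE.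
  by move: hn hsub hdisc restE; rewrite /beta !mulrDl; lra.
suff lower : h - hD <= beta * s.
  by rewrite ler_norml; clear -upper lower; apply/andP; split; lra.
have nwc : continuous (fun z : R * R => - v z.1 z.2).
  by move=> z; apply: continuousN; exact: (visc_continuous vh).
have NVP : doubly_periodic N K (fun k m => - V k m).
  by have [[Vx Vt] _ _] := solV; split => k m o; rewrite ?Vx ?Vt.
have [k [m [z [em hz touch]]]] := @doubling_variables R N K N0 K0
  (fun z => - v z.1 z.2) (fun k m => - V k m) s s0 nwc
  (fun t x => congr1 -%R (wcx t x)) (fun x t => congr1 -%R (wct x t)) NVP.
have := touching_above H_ass N0 NK cfl1 solV s0 em touch.
have : forall z', v z.1 z.2 - (-1) * penalty s (node N K k.+1 m) z
    <= v z'.1 z'.2 - (-1) * penalty s (node N K k.+1 m) z'.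
  by move=> z'; have := hz z'; clear; rewrite !mulN1r; lra.
move/(super_penalty_test vh s0); rewrite !mulN1r /=.
set P := (z.1 - _) / s; set Q := (z.2 - _) / s => hsup.
have zx : `|z.1 - xg N m| = s * `|- P|.
  by rewrite normrN /P normrM normfV (gtr0_norm s0) mulrC divfK // gt_eqF.
have zt : z.2 - tg K k.+1 = s * Q by rewrite /Q mulrC divfK // gt_eqF.
rewrite dxs => -[p1 p2 [S [S0 SE] hdisc]].
have em1 : even_node k.+1 (m - 1) by move: em; rewrite /even_node; clear; lia.
have em2 : even_node k.+1 (m + 1) by move: em; rewrite /even_node; clear; lia.
have [cP PM] := small _ _ _ (VM _ _ em2) (VM _ _ em1) p1 p2.
have H1 := hHM (xg N m) (tg K k) _ (MM2 _ (VM _ _ em)); have H2 := hHM z.1 z.2 _ cP.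
have QM : `|Q| <= Qm.
  clear -H1 H2 hDb hb hsup S0 SE restE rest0 Ces Ce0 HM0.
  move: H1 H2 hDb hb; rewrite /Qm !ler_norml => /andP[? ?] /andP[? ?] /andP[? ?] /andP[? ?].
  by apply/andP; split; lra.
have Sle : S <= 2 * HM + Qm + Ce.
  clear -H1 hDb QM SE restE Ces.
  by move: H1 hDb QM; rewrite !ler_norml => /andP[? ?] /andP[? ?] /andP[? ?]; lra.
(* H_p at the node (k, m) against the CFL bound at (k.+1, m + j). *)
have near_slope (j : int) (u : R) : j = 1 \/ j = -1 -> `|c + slope N V k.+1 (m + j)| <= M ->
    `|u - (c + slope N V k.+1 (m + j))| <= s ->
    `|H_p H (xg N m) (tg K k) u| <= B + 3 * L' * s.
  move=> j1 uM us; have [_ VB _] := solV.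
  have ej : even_node k.+1 (m + j) by case: j1 => ->.
  have u2 : `|u| <= M2.
    rewrite -(subrK (c + slope N V k.+1 (m + j)) u) /M2.
    by apply: le_trans (ler_normD _ _) _; clear -us uM s1 Cc0; lra.
  have := hL' (xg N m) (tg K k) u (xg N (m + j)) (tg K k.+1) _ u2 (MM2 _ uM).
  have -> : `|xg N m - xg N (m + j)| = dx N :> R.
    rewrite xgD opprD addrA subrr sub0r normrN normrM (gtr0_norm dx0).
    by case: j1 => ->; rewrite ?normrN normr1 mul1r.
  have -> : `|tg K k - tg K k.+1| = dt K :> R.
    by rewrite tgS opprD addrA subrr sub0r normrN gtr0_norm.
  move=> hl; have := VB _ _ ej; rewrite -(subrK (H_p H (xg N (m + j)) (tg K k.+1)
    (c + slope N V k.+1 (m + j))) (H_p H (xg N m) (tg K k) u)) => hB.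
  apply: le_trans (ler_normD _ _) _; rewrite addrC; apply: lerD => //.
  apply: le_trans hl _; rewrite [3 * L']mulrC -mulrA ler_wpM2l ?(ltW L'0) //.
  by clear -us dt_dx dx_s; lra.
have HpP : `|H_p H (xg N m) (tg K k) (c - P)| <= B + 3 * L' * s.
  have ns1 : `|H_p H (xg N m) (tg K k) (c + slope N V k.+1 (m + 1) - s)| <= B + 3 * L' * s.
    apply: (near_slope 1) => //; [by left | exact: VM |].
    by rewrite addrAC subrr sub0r normrN gtr0_norm.
  have ns2 : `|H_p H (xg N m) (tg K k) (c + slope N V k.+1 (m - 1) + s)| <= B + 3 * L' * s.
    apply: (near_slope (-1)) => //; [by right | exact: VM |].
    by rewrite addrAC subrr add0r gtr0_norm.
  have m1 : H_p H (xg N m) (tg K k) (c + slope N V k.+1 (m + 1) - s)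
      <= H_p H (xg N m) (tg K k) (c - P).
    by apply: H_p_nondecreasing => //; clear -p1; lra.
  have m2 : H_p H (xg N m) (tg K k) (c - P)
      <= H_p H (xg N m) (tg K k) (c + slope N V k.+1 (m - 1) + s).
    by apply: H_p_nondecreasing => //; clear -p2; lra.
  clear -ns1 ns2 m1 m2; move: ns1 ns2; rewrite !ler_norml => /andP[? _] /andP[_ ?].
  by apply/andP; split; lra.
have eta0 : 0 <= 3 * L' * s by rewrite !mulr_ge0 // ltW.
have := hdisc _ eta0 HpP.
have : 3 * L' * s * S <= 3 * L' * s * (2 * HM + Qm + Ce) by exact: ler_wpM2l.
have := near_point z k m (- P) Q zx zt cP PM QM _ erefl.
rewrite ler_norml => /andP[hn _].
by clear -hn hsup restE; move: hn hsup restE; rewrite /beta !mulrDl; lra.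
Qed.

(** * The theorem *)

Theorem theorem3p7 (R : realType) (H : R -> R -> R -> R)
    (r c0 c1 beta1 lam0 lam1 delta : R)
    (hbarD : nat -> nat -> R -> R) (hbar : R -> R)
    (H_ass : hamiltonian_assumptions H)
    (r_gt0 : 0 < r) (c0_le_c1 : c0 <= c1)
    (beta1_gt0 : 0 < beta1)
    (beta1_bound : forall c : R, c0 <= c <= c1 -> forall u0 : R -> R,
      (exists r', Linf0 r' u0) ->
      forall u, entropy_solution H c u0 u -> (Linf_norm (u ^~ 1%R) <= beta1%:E)%E)
    (r_ge : beta1 + 1 <= r)
    (lam0_gt0 : 0 < lam0) (lam0_lt_lam1 : lam0 < lam1) (delta_gt0 : 0 < delta)
    (mesh_bound : forall N K : nat, mesh lam0 lam1 delta N K ->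
      forall c : R, c0 <= c <= c1 -> forall u0 : R -> R, Linf0 r u0 ->
      forall u, lf_solution H N K c u0 u ->
        (forall k m, even_node k m ->
           `|H_p H (xg N m) (tg K k) (c + u k m)| <= lam1^-1
             < (dt K / dx N)^-1) /\
        (Linf_norm (u_interp N K u ^~ 1%R) <= (beta1 + 1)%R%:E)%E)
    (hbarD_eff : forall N K : nat, mesh lam0 lam1 delta N K ->
      forall c : R, c0 <= c <= c1 ->
      discrete_effective_hamiltonian H N K r c (hbarD N K c))
    (hbar_eff : forall c : R, c0 <= c <= c1 -> effective_hamiltonian H c (hbar c)) :
  (forall N K : nat, mesh lam0 lam1 delta N K ->
     [/\ forall c : R, c0 <= c <= c1 ->
           unique (has_periodic_hj_solution H N K r c) (hbarD N K c),
         forall c : R, c0 <= c <= c1 ->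
           forall u, periodic_lf_solution H N K r c u ->
           hbarD N K c = averaged_hamiltonian H N K c u,
         forall c : R, c0 <= c <= c1 ->
           forall (v0 : R -> R) v, hj_solution H N K c 0 r v0 v ->
           forall n : int,
             v l.+1 n / tg K l.+1
               @[l --> within [set l : nat | ~~ even_node l.+1 n] \oo]
             --> - hbarD N K c
       & convex_function (`[c0, c1] : set R) (hbarD N K)
         /\ C1_on c0 c1 (hbarD N K)]) /\
  ({uniform `[c0, c1],
      (fun NK : nat * nat => hbarD NK.1 NK.2)
        @ within [set NK | mesh lam0 lam1 delta NK.1 NK.2]
                 (filter_prod \oo \oo) --> hbar} /\
   exists2 beta3 : R, 0 < beta3 &
     forall N K : nat, mesh lam0 lam1 delta N K ->
       (ereal_sup [set (`|hbarD N K c - hbar c|%R)%:E | c in `[c0, c1]]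
         <= (beta3 * Num.sqrt (dx N))%R%:E)%E).
Proof.
have lam10 : 0 < lam1 by exact: lt_trans lam0_lt_lam1.
have B0 : 0 <= lam1^-1 by rewrite invr_ge0 ltW.
have r0 : 0 <= r by exact: ltW.
have mesh_cfl N K : mesh lam0 lam1 delta N K -> lam1^-1 * (dt K / dx N) < 1.
  by move=> [_ /andP[_ lt1] _]; rewrite mulrC ltr_pdivrMr // mul1r.
have lf_cfl N K : mesh lam0 lam1 delta N K -> forall c, c0 <= c <= c1 ->
    forall u0, Linf0 r u0 -> forall u, lf_solution H N K c u0 u ->
    forall k m, even_node k m -> `|H_p H (xg N m) (tg K k) (c + u k m)| <= lam1^-1.
  move=> hM c hc u0 hu0 u hu k m em.
  by have [hB _] := mesh_bound N K hM c hc u0 hu0 u hu; have /andP[] := hB k m em.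
have sol N K (hM : mesh lam0 lam1 delta N K) c (hc : c0 <= c <= c1) :
    exists V, periodic_solution H N K lam1^-1 c (hbarD N K c) V.
  have [/andP[N0 NK] _ _] := hM.
  have [_ [V [_ sV]]] := fixed_point_periodic_solution H_ass N0 NK r0
    (lf_cfl N K hM c hc) (hbarD_eff N K hM c hc).
  by exists V.
have [beta beta0 hbeta] := effective_error H_ass B0 lam0_gt0
  (addr_ge0 (normr_ge0 c0) (normr_ge0 c1)).
have err N K c : mesh lam0 lam1 delta N K -> c0 <= c <= c1 ->
    `|hbarD N K c - hbar c| <= beta * Num.sqrt (dx N).
  move=> hM hc; have [hN /andP[lamge _] _] := hM; have [V sV] := sol N K hM c hc.
  have [[v hv] _] := hbar_eff c hc.
  apply: (hbeta _ _ hN lamge (mesh_cfl _ _ hM) c _ _ _ sV _ _ hv).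
  move: hc => /andP[h0 h1]; rewrite ler_norml.
  have := ler_norm c1; have := normr_ge0 c1; have := normr_ge0 c0.
  have := ler_norm (- c0); rewrite normrN => *; apply/andP; split; lra.
split.
  move=> N K hM; have [/andP[N0 NK] _ _] := hM.
  have cfl1 := mesh_cfl N K hM.
  split.
  - move=> c hc.
    exact: (discrete_effective_unique H_ass N0 NK r0 cfl1 (lf_cfl N K hM c hc) (hbarD_eff N K hM c hc)).
  - move=> c hc u.
    exact: (periodic_lf_average H_ass N0 NK r0 cfl1 (lf_cfl N K hM c hc) (hbarD_eff N K hM c hc)).
  - move=> c hc v0 v hv; have [V sV] := sol N K hM c hc.
    apply: (long_time_average H_ass N0 NK cfl1 (hj_periodic hv) _ _ sV).
      exact: (hj_solution_cfl N0 NK r0 (lf_cfl N K hM c hc) hv).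
    apply/hj_equationP; [exact: leq_trans N0 NK | exact: hj_scheme hv].
  split.
    move=> t x y; rewrite !inE /= !in_itv /= => hx hy.
    have [Vx [px cx ex]] := sol N K hM x hx; have [Vy [py cy ey]] := sol N K hM y hy.
    have t01 : 0 <= t%:num <= 1 by apply/andP; split.
    rewrite !convRE.
    have hz : c0 <= t%:num * x + (1 - t%:num) * y <= c1.
      move: hx hy t01 => /andP[? ?] /andP[? ?] /andP[? ?]; apply/andP; split; nra.
    have [Vz [pz cz ez]] := sol N K hM _ hz.
    exact: (hj_convex H_ass N0 NK cfl1 t01 px py pz cx cy cz ex ey ez).
  have [C C0 hC] := effective_three_point H_ass N0 NK B0 cfl1.
  apply: (C1_on_three_point c0_le_c1 C0) => x y z hx hy hz yx zx.
  have [Vx sx] := sol N K hM x hx; have [Vy sy] := sol N K hM y hy.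
  by have [Vz sz] := sol N K hM z hz; exact: hC sx sy sz yx zx.
split; last first.
  exists beta => // N K hM; apply: ge_ereal_sup => _ [c /= + <-].
  by rewrite in_itv /= lee_fin => hc; exact: err.
move=> P /uniform_nbhs[E [+ EP]]; rewrite -entourage_ballE => -[e /= e0 eE].
pose x := (e / beta) ^+ 2.
have x0 : 0 < x by rewrite exprn_gt0 // divr_gt0.
(* Only N matters: beyond 1/x one has dx N < x = (e / beta) ^ 2. *)
exists ([set N | (Num.truncn x^-1 < N)%N], [set: nat]).
  by split => //=; [exists (Num.truncn x^-1).+1 | exact: filterT].
move=> [N K] /= [hN _] hM; have N0 : (0 < N)%N by exact: leq_ltn_trans hN.
apply: EP => c /=; rewrite in_itv /= => hc; apply: eE => /=.
rewrite /ball /= distrC; apply: le_lt_trans (err _ _ _ hM hc) _.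
rewrite mulrC -ltr_pdivlMr //.
have -> : e / beta = Num.sqrt x by rewrite sqrtr_sqr gtr0_norm // divr_gt0.
(* From here on x is any positive number. *)
move: x x0 hN => x x0 hN.
rewrite ltr_sqrt // /dx -[ltRHS]invrK ltf_pV2 ?posrE ?invr_gt0 ?mulr_gt0 ?ltr0n //.
have : x^-1 < N%:R by apply: lt_le_trans (truncnS_gt _) _; rewrite ler_nat.
have : 0 <= N%:R :> R by [].
lra.
Qed.
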